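(* Let $(M,g)$ be a compact connected pseudo-Kähler manifold with complex-structure tensor $J$, such that the complex manifold $M$ has the $\partial\overline{\partial}$ property, and let $\omega=g(J\,\cdot\,,\,\cdot\,)$ be its Kähler form. If $v$ is an affine vector field on $(M,g)$, then $\mathcal{L}_v\omega=0$, where $\mathcal{L}_v$ denotes the Lie derivative.
   Context: All manifolds and tensor fields are smooth; manifolds are connected. A pseudo-Kähler manifold is a pseudo-Riemannian manifold $(M,g)$ (the metric $g$ need not be definite) endowed with an almost-complex structure $J$ which is parallel for the Levi-Civita connection $\nabla$ of $g$ and makes $g$ Hermitian, i.e. $g(J\cdot,J\cdot)=g$. Then $J$ is integrable, so $M$ is a complex manifold. A compact complex manifold $M$ has the $\partial\overline{\partial}$ property if, for all integers $p,q\ge 0$, every closed complex-valued $(p,q)$-form on $M$ that is $\partial$-exact or $\overline{\partial}$-exact equals $\partial\overline{\partial}\lambda$ for some $(p-1,q-1)$-form $\lambda$ (in particular it is zero if $p=0$ or $q=0$). A vector field $v$ on $(M,g)$ is affine if its local flow preserves the Levi-Civita connection $\nabla$ of $g$ (equivalently $\mathcal{L}_v\nabla=0$). *)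

(* Defs.v *)
From HB Require Import structures.
From mathcomp Require Import all_boot all_order all_algebra.
From mathcomp Require Import all_classical all_reals all_analysis.
From mathcomp Require Import ring.

Set Implicit Arguments.
Unset Strict Implicit.
Unset Printing Implicit Defensive.

Import Order.TTheory GRing.Theory Num.Theory.
Import numFieldNormedType.Exports.

Local Open Scope classical_set_scope.
Local Open Scope ring_scope.

(* [f] is of class C^k on the open set [U]: its iterated partial derivatives of
   order at most [k] exist and are continuous on [U]. *)
Fixpoint Ck (R : realType) (n k : nat) (U : set 'rV[R]_n) (f : 'rV[R]_n -> R)
    : Prop :=
  (forall x, U x -> {for x, continuous f}) /\
  if k is k'.+1 then
    forall i : 'I_n,
      (forall x, U x -> derivable f x (delta_mx 0 i)) /\
      Ck k' U (fun x => 'D_(delta_mx 0 i) f x)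
  else True.

Definition smooth_on (R : realType) (n : nat) (U : set 'rV[R]_n)
    (f : 'rV[R]_n -> R) : Prop :=
  forall k, Ck k U f.

Section SmoothOn.
Context (R : realType) (n : nat) (U : set 'rV[R]_n).
Hypothesis oU : open U.

Lemma Ck_ext k (f g : 'rV[R]_n -> R) :
  (forall x, U x -> f x = g x) -> Ck k U f -> Ck k U g.
Proof.
have near_ext (u v : 'rV[R]_n -> R) : (forall x, U x -> u x = v x) ->
    forall x, U x -> {near x, u =1 v}.
  move=> uv x Ux; have := open_nbhs_nbhs (conj oU Ux).
  by apply: filterS => y /uv.
have cont_ext (u v : 'rV[R]_n -> R) : (forall x, U x -> u x = v x) ->
    forall x, U x -> {for x, continuous u} -> {for x, continuous v}.
  move=> uv x Ux cu; rewrite /prop_for /continuous_at -(uv _ Ux).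
  have F : Filter (nbhs x) by exact: nbhs_filter.
  exact: (cvg_trans (@near_eq_cvg _ _ (nbhs x) F u v (near_ext _ _ uv x Ux))).
elim: k f g => [|k IH] f g fg /= [cf Hf]; split=> //.
- by move=> x Ux; exact: (cont_ext _ _ fg x Ux (cf x Ux)).
- by move=> x Ux; exact: (cont_ext _ _ fg x Ux (cf x Ux)).
- move=> i; have [df Df] := Hf i; split.
    by move=> x Ux; exact: near_eq_derivable (near_ext _ _ fg x Ux) (df x Ux).
  by apply: IH Df => x Ux; exact: near_eq_derive (near_ext _ _ fg x Ux).
Qed.

Lemma CkS k (f : 'rV[R]_n -> R) : Ck k.+1 U f -> Ck k U f.
Proof.
elim: k f => [|k IH] f /= [cf Hf]; first by split.
by split=> // i; have [df Df] := Hf i; split=> //; exact: IH.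
Qed.

Lemma Ck_cst k (a : R) : Ck k U (cst a).
Proof.
elim: k a => [|k IH] a /=; split=> //; try by move=> x _; exact: cst_continuous.
move=> i; split; first by move=> x _; exact: derivable_cst.
by apply: (Ck_ext _ (IH 0)) => x _; rewrite [RHS]derive_cst.
Qed.

Lemma CkD k (f g : 'rV[R]_n -> R) : Ck k U f -> Ck k U g -> Ck k U (f \+ g).
Proof.
elim: k f g => [|k IH] f g /= [cf Hf] [cg Hg]; split=> //.
- by move=> x Ux; apply: continuousD; [exact: cf | exact: cg].
- by move=> x Ux; apply: continuousD; [exact: cf | exact: cg].
- move=> i; have [df Df] := Hf i; have [dg Dg] := Hg i; split.
    by move=> x Ux; apply: derivableD; [exact: df | exact: dg].
  apply: (Ck_ext _ (IH _ _ Df Dg)) => x Ux /=.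
  by rewrite [RHS]deriveD//; [exact: df | exact: dg].
Qed.

Lemma CkM k (f g : 'rV[R]_n -> R) : Ck k U f -> Ck k U g -> Ck k U (f \* g).
Proof.
elim: k f g => [|k IH] f g.
  by move=> /= [cf _] [cg _]; split=> // x Ux;
    apply: continuousM; [exact: cf | exact: cg].
move=> /[dup] /CkS kf /= [cf Hf] /[dup] /CkS kg /= [cg Hg]; split.
  by move=> x Ux; apply: continuousM; [exact: cf | exact: cg].
move=> i; have [df Df] := Hf i; have [dg Dg] := Hg i; split.
  by move=> x Ux; apply: derivableM; [exact: df | exact: dg].
apply: (Ck_ext _ (CkD (IH _ _ kf Dg) (IH _ _ kg Df))) => x Ux /=.
by rewrite [RHS]deriveM//; [exact: df | exact: dg].
Qed.

End SmoothOn.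

(* A (not necessarily maximal) smooth atlas of dimension [n] on [M].  The maps
   [chart_fwd i] and [chart_inv i] are total functions, but only their values
   on [chart_dom i] and on its image are meaningful. *)
Record atlas (R : realType) (n : nat) (M : topologicalType) := Atlas {
  chart_index : Type;
  chart_dom : chart_index -> set M;
  chart_fwd : chart_index -> M -> 'rV[R]_n;
  chart_inv : chart_index -> 'rV[R]_n -> M;
  chart_cover : forall p, exists i, chart_dom i p;
  chart_dom_open : forall i, open (chart_dom i);
  chart_img_open : forall i, open (chart_fwd i @` chart_dom i);
  chart_fwdK : forall i p, chart_dom i p -> chart_inv i (chart_fwd i p) = p;
  chart_fwd_continuous : forall i p, chart_dom i p ->
    {for p, continuous (chart_fwd i)};
  chart_inv_continuous : forall i x, (chart_fwd i @` chart_dom i) x ->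
    {for x, continuous (chart_inv i)};
  chart_transition : forall i j (k : 'I_n),
    smooth_on (chart_fwd i @` (chart_dom i `&` chart_dom j))
      (fun x => chart_fwd j (chart_inv i x) ord0 k)
}.

Arguments chart_dom {R n M} a i.
Arguments chart_fwd {R n M} a i.
Arguments chart_inv {R n M} a i.

Section Manifold.
Context (R : realType) (n : nat) (M : topologicalType) (A : atlas R n M).

Definition smooth (f : M -> R) : Prop :=
  forall i, smooth_on (chart_fwd A i @` chart_dom A i) (f \o chart_inv A i).

Definition smooth_pred : {pred M -> R} := fun f => `[< smooth f >].

Lemma smooth_cstP (a : R) : smooth (cst a).
Proof. by move=> i k; apply: Ck_cst; exact: chart_img_open. Qed.

Lemma smooth_subring_closed : subring_closed smooth_pred.
Proof.
split=> [|f g /asboolP sf /asboolP sg|f g /asboolP sf /asboolP sg];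
  apply/asboolP.
- exact: (smooth_cstP 1).
- move=> i k; have oI := chart_img_open (i := i).
  have kN := CkM oI (Ck_cst oI k (-1)) (sg i k).
  apply: (Ck_ext oI _ (CkD oI (sf i k) kN)) => // x _ /=.
  by rewrite /cst mulN1r.
- move=> i k; have oI := chart_img_open (i := i).
  by apply: (Ck_ext oI _ (CkM oI (sf i k) (sg i k))).
Qed.

HB.instance Definition _ :=
  GRing.isSubringClosed.Build _ smooth_pred smooth_subring_closed.

Record smooth_fun := SmoothFun {
  smooth_fun_val :> M -> R;
  smooth_funP : smooth_fun_val \in smooth_pred
}.

HB.instance Definition _ := [isSub for smooth_fun_val].
HB.instance Definition _ := [Choice of smooth_fun by <:].
HB.instance Definition _ := GRing.SubChoice_isSubComPzRing.Build _ _ smooth_fun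
  smooth_subring_closed.

Definition smooth_cst (a : R) : smooth_fun :=
  SmoothFun (introT (asboolP _) (smooth_cstP a)).

(* On a compact Hausdorff manifold every R-linear derivation of C^oo(M) comes
   from a unique smooth vector field. *)
Definition is_derivation (X : smooth_fun -> smooth_fun) : Prop :=
  (forall (a : R) f h, X (smooth_cst a * f + h) = smooth_cst a * X f + X h) /\
  (forall f h, X (f * h) = f * X h + X f * h).

Definition derivation_pred : {pred smooth_fun -> smooth_fun} :=
  fun X => `[< is_derivation X >].

Lemma derivation_zmod_closed : zmod_closed derivation_pred.
Proof.
split=> [|X Y /asboolP[lX dX] /asboolP[lY dY]]; apply/asboolP; split.
- by move=> a f h; rewrite /GRing.zero/= mulr0 addr0.
- by move=> f h; rewrite /GRing.zero/= mulr0 mul0r addr0.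
- move=> a f h; rewrite -[LHS]/(X _ - Y _) lX lY.
  rewrite -[(X - Y) f]/(X f - Y f) -[(X - Y) h]/(X h - Y h); ring.
- move=> f h; rewrite -[LHS]/(X _ - Y _) dX dY.
  rewrite -[(X - Y) f]/(X f - Y f) -[(X - Y) h]/(X h - Y h); ring.
Qed.

HB.instance Definition _ :=
  GRing.isZmodClosed.Build _ derivation_pred derivation_zmod_closed.

Record vfield := VField {
  vfield_fun :> smooth_fun -> smooth_fun;
  vfieldP : vfield_fun \in derivation_pred
}.

HB.instance Definition _ := [isSub for vfield_fun].
HB.instance Definition _ := [Choice of vfield by <:].
HB.instance Definition _ := [SubChoice_isSubZmodule of vfield by <:].

Lemma vfield_scale_subproof (f : smooth_fun) (X : vfield) :
  (fun h => f * X h) \in derivation_pred.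
Proof.
have /asboolP[lX dX] := vfieldP X.
by apply/asboolP; split=> [a h k|h k]; rewrite ?lX ?dX; ring.
Qed.

Definition vfield_scale (f : smooth_fun) (X : vfield) : vfield :=
  VField (vfield_scale_subproof f X).

Lemma vfield_scaleA f h X :
  vfield_scale f (vfield_scale h X) = vfield_scale (f * h) X.
Proof. by apply: val_inj; apply/funext => k; rewrite /= mulrA. Qed.

Lemma vfield_scale1 : left_id 1 vfield_scale.
Proof. by move=> X; apply: val_inj; apply/funext => k; rewrite /= mul1r. Qed.

Lemma vfield_scaleDr : right_distributive vfield_scale +%R.
Proof. by move=> f X Y; apply: val_inj; apply/funext => k; rewrite /= mulrDr. Qed.

Lemma vfield_scaleDl X : {morph vfield_scale^~ X : f h / f + h}.
Proof. by move=> f h; apply: val_inj; apply/funext => k; rewrite /= mulrDl. Qed.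

HB.instance Definition _ := GRing.Zmodule_isLmodule.Build smooth_fun vfield
  vfield_scaleA vfield_scale1 vfield_scaleDr vfield_scaleDl.

Lemma lie_bracket_subproof (X Y : vfield) :
  (fun f => X (Y f) - Y (X f)) \in derivation_pred.
Proof.
have /asboolP[lX dX] := vfieldP X; have /asboolP[lY dY] := vfieldP Y.
have aX f h : X (f + h) = X f + X h.
  have := lX 1 f h; rewrite (_ : smooth_cst 1 = 1) ?mul1r //.
  exact: val_inj.
have aY f h : Y (f + h) = Y f + Y h.
  have := lY 1 f h; rewrite (_ : smooth_cst 1 = 1) ?mul1r //.
  exact: val_inj.
apply/asboolP; split=> [a f h|f h]; first by rewrite !(lX, lY); ring.
by rewrite !(dX, dY) !(aX, aY) !(dX, dY); ring.
Qed.

Definition lie_bracket (X Y : vfield) : vfield :=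
  VField (lie_bracket_subproof X Y).

(* Tensor fields are C^oo(M)-multilinear maps on vector fields; nondegeneracy
   is required in each tangent space, a vector field vanishing at [p] exactly
   when it kills every function at [p]. *)
Definition is_metric (g : vfield -> vfield -> smooth_fun) : Prop :=
  [/\ forall f (X Y Z : vfield), g (f *: X + Y) Z = f * g X Z + g Y Z,
      forall X Y : vfield, g X Y = g Y X &
      forall (p : M) (X : vfield), (forall Y, g X Y p = 0) -> forall f, X f p = 0].

Definition is_levi_civita (g : vfield -> vfield -> smooth_fun)
    (D : vfield -> vfield -> vfield) : Prop :=
  [/\ forall f (X Y Z : vfield), D (f *: X + Y) Z = f *: D X Z + D Y Z,
      forall X Y Z : vfield, D X (Y + Z) = D X Y + D X Z,
      forall f (X Y : vfield), D X (f *: Y) = f *: D X Y + X f *: Y,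
      forall X Y : vfield, D X Y - D Y X = lie_bracket X Y &
      forall X Y Z : vfield, X (g Y Z) = g (D X Y) Z + g Y (D X Z)].

Definition is_almost_complex (J : {linear vfield -> vfield}) : Prop :=
  forall X, J (J X) = - X.

Definition is_pseudo_kahler (g : vfield -> vfield -> smooth_fun)
    (D : vfield -> vfield -> vfield) (J : {linear vfield -> vfield}) : Prop :=
  [/\ is_metric g, is_levi_civita g D, is_almost_complex J,
      forall X Y : vfield, g (J X) (J Y) = g X Y &
      forall X Y : vfield, D X (J Y) = J (D X Y)].

Definition kahler_form (g : vfield -> vfield -> smooth_fun)
    (J : {linear vfield -> vfield}) : vfield -> vfield -> smooth_fun :=
  fun X Y => g (J X) Y.

Definition lie_derivative (v : vfield) (b : vfield -> vfield -> smooth_fun)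
    : vfield -> vfield -> smooth_fun :=
  fun X Y => v (b X Y) - b (lie_bracket v X) Y - b X (lie_bracket v Y).

Definition lie_derivative_connection (v : vfield)
    (D : vfield -> vfield -> vfield) : vfield -> vfield -> vfield :=
  fun X Y =>
    lie_bracket v (D X Y) - D (lie_bracket v X) Y - D X (lie_bracket v Y).

Definition is_affine (D : vfield -> vfield -> vfield) (v : vfield) : Prop :=
  forall X Y : vfield, lie_derivative_connection v D X Y = 0.

(* [(f, h)] stands for the complex-valued function [f + i h]. *)
Definition cfun : Type := smooth_fun * smooth_fun.
HB.instance Definition _ := GRing.Zmodule.on cfun.

Definition cfun_scale (f : smooth_fun) (u : cfun) : cfun := (f * u.1, f * u.2).
Definition mul_i (u : cfun) : cfun := (- u.2, u.1).
Definition vfield_app (X : vfield) (u : cfun) : cfun := (X u.1, X u.2).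

Definition cochain (k : nat) : Type := ('I_k -> vfield) -> cfun.
HB.instance Definition _ k := GRing.Zmodule.on (cochain k).

Definition is_form k (a : cochain k) : Prop :=
  (forall (i : 'I_k) (f : smooth_fun) (X Y Z : 'I_k -> vfield),
     Z i = f *: X i + Y i ->
     (forall j, j != i -> X j = Z j /\ Y j = Z j) ->
     a Z = cfun_scale f (a X) + a Y) /\
  (forall (i j : 'I_k) (X : 'I_k -> vfield),
     i != j -> X i = X j -> a X = 0).

(* The invariant formula for the exterior derivative
     d a (X_0, ..., X_k) = \sum_j (-1)^j X_j (a (X_0, .. omit X_j .., X_k))
       + \sum_(i < j) (-1)^(i + j) a ([X_i, X_j], .. omit X_i and X_j ..),
   in which the bracket has been moved from the first slot to the slot of X_i,
   at the cost of a sign (-1)^i. *)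
Definition ext_d k (a : cochain k) : cochain k.+1 := fun X =>
  \sum_(j < k.+1) cfun_scale ((-1) ^+ j)
    (vfield_app (X j) (a (fun m => X (lift j m))) +
     \sum_(i < k.+1 | (i < j)%N)
       a (fun m => if lift j m == i then lie_bracket (X i) (X j)
                   else X (lift j m))).

(* The complex-multilinear extension of [a], evaluated at the complex vector
   fields [(Z j).1 + i (Z j).2]. *)
Definition complexify k (a : cochain k) (Z : 'I_k -> vfield * vfield) : cfun :=
  \sum_(T : {set 'I_k})
    iter #|T| mul_i (a (fun j => if j \in T then (Z j).2 else (Z j).1)).

Section Bidegree.
Context (J : {linear vfield -> vfield}).

(* The components (X -/+ i J X) / 2 of [X] of types (1,0) and (0,1). *)
Definition part10 (X : vfield) : vfield * vfield :=
  let h := smooth_cst 2^-1 in (h *: X, - (h *: J X)).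
Definition part01 (X : vfield) : vfield * vfield :=
  let h := smooth_cst 2^-1 in (h *: X, h *: J X).

(* The component of type (p, k - p) of a k-form. *)
Definition type_part k (p : nat) (a : cochain k) : cochain k := fun X =>
  \sum_(S : {set 'I_k} | #|S| == p)
    complexify a (fun j => if j \in S then part10 (X j) else part01 (X j)).

Definition has_type k (p q : nat) (a : cochain k) : Prop :=
  (p + q)%N = k /\ type_part p a = a.

(* On the (p, q)-component, d followed by the projection to type (p + 1, q),
   resp. (p, q + 1); the components are indexed by [p], with [p + q = k]. *)
Definition del k (a : cochain k) : cochain k.+1 :=
  \sum_(p < k.+1) type_part p.+1 (ext_d (type_part p a)).

Definition delbar k (a : cochain k) : cochain k.+1 :=
  \sum_(p < k.+1) type_part p (ext_d (type_part p a)).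

(* There are no nonzero forms of degree -1, so an exact 0-form is zero. *)
Definition del_exact k : cochain k -> Prop :=
  match k with
  | k'.+1 => fun a => exists2 b : cochain k', is_form b & a = del b
  | 0 => fun a => a = 0
  end.

Definition delbar_exact k : cochain k -> Prop :=
  match k with
  | k'.+1 => fun a => exists2 b : cochain k', is_form b & a = delbar b
  | 0 => fun a => a = 0
  end.

(* [del (delbar b)] for a form [b] of type (p - 1, q - 1); there is no nonzero
   such form when [p = 0] or [q = 0]. *)
Definition deldelbar_exact (p q : nat) k : cochain k -> Prop :=
  match p, q, k with
  | p'.+1, q'.+1, k'.+2 => fun a => exists b : cochain k',
      [/\ is_form b, has_type p' q' b & a = del (delbar b)]
  | _, _, _ => fun a => a = 0
  end.

Definition deldelbar_property : Prop :=
  forall (p q k : nat) (a : cochain k),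
    is_form a -> has_type p q a -> ext_d a = 0 ->
    del_exact a \/ delbar_exact a -> deldelbar_exact p q a.

End Bidegree.

End Manifold.

(* Main.v *)
Require Import Defs.
From mathcomp Require Import all_boot all_order all_algebra.
From mathcomp Require Import all_classical all_reals all_analysis.
From mathcomp Require Import ring lra.

Set Implicit Arguments.
Unset Strict Implicit.
Unset Printing Implicit Defensive.

Import Order.TTheory GRing.Theory Num.Theory.
Import numFieldNormedType.Exports.

Local Open Scope classical_set_scope.
Local Open Scope ring_scope.

(* Let eta = omega(v, .) and alpha = L_v omega = d eta.  As v is affine, alpha
   is parallel, and so are its components of each bidegree, which are therefore
   closed.  The (2, 0)-part of alpha is del eta10, hence zero by the
   del-delbar property with q = 0; then d eta10 is closed, of type (1, 1) and
   equal to delbar eta10, so that it is del (delbar b) for a complex function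
   b.  Taking real parts, alpha(X, J X) = H(X, X) + H(J X, J X), where H is the
   Hessian of the function w = Im b.  The parallel symmetric form
   beta = alpha(., J .) is thus nonpositive at a maximum of w and nonnegative
   at a minimum.  Both signs propagate over the connected manifold, because a
   parallel form solves a linear differential equation along curves, so beta
   and alpha vanish.

   Vector fields being derivations, their local description rests on
   Hadamard's lemma and on bump functions. *)

(** * Integrals depending on a parameter *)

(** As g may be indefinite, positivity cannot come from a Laplacian or from integrating against g.
    It comes from w: at a critical point the term (D_X X) w of H(X, X) drops out, so H has a sign at
    an extremum whatever the signature of g. The imaginary part of b appears because conjugation
    anticommutes with del delbar, whence Re (del delbar b) = i del delbar w.

    Since alpha is real, killing its (2, 0)-part makes it of type (1, 1). This is what makes beta
    symmetric, so that its diagonal determines it.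

    The differential equation along curves is never solved and no parallel transport is built: the
    matrix of beta in a frame is a given solution, and a maximum argument over [0, 1] times a sphere
    keeps it nonpositive.

    Only global vector fields are available, so coordinate fields occur multiplied by a bump
    function rho; this is the source of the powers of rho. The class C^k is phrased by partial
    derivatives, and the chain rule is itself deduced from Hadamard's lemma. *)

Lemma cvg_mx (T : Type) (F : set_system T) (R : numFieldType) m n
    (f : T -> 'M[R]_(m, n)) (a : 'M[R]_(m, n)) : Filter F ->
  (forall i j, f t i j @[t --> F] --> a i j) -> f @ F --> a.
Proof.
move=> FF fa A [P Pa sPA]; apply: (@filterS _ _ _ [set t | forall ij, P ij.1
  ij.2 (f t ij.1 ij.2)]).
  by move=> t Pt; apply: sPA => i j; exact: (Pt (i, j)).
by apply: filter_forall => -[i j] /=; apply: fa; exact: Pa.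
Qed.

(** The difference quotient in direction [w] is literally that of the restriction to the line. With
    [is_derive_lineP] this trades directional derivatives for derivatives on R. *)
Lemma is_derive_line (R : numFieldType) (V W : normedModType R) (f : V -> W)
    (a w : V) (c : R) : derivable f (a + c *: w) w ->
  is_derive c (1 : R) (fun s : R => f (a + s *: w)) ('D_w f (a + c *: w)).
Proof.
have e : (fun h : R => h^-1 *: (((fun s : R => f (a + s *: w)) \o shift c) (h
  *: 1)
    - f (a + c *: w))) = fun h => h^-1 *: ((f \o shift (a + c *: w)) (h *: w)
    - f (a + c *: w)).
  apply/funext => h /=; congr (_ *: (f _ - _)).
  by rewrite [_%:A]mulr1 scalerDl addrCA.
move=> df; apply: DeriveDef; first by rewrite /derivable e.
by rewrite /derive e.
Qed.

Lemma is_derive_lineP (R : numFieldType) (V W : normedModType R) (f : V -> W)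
    (a w : V) (d : W) : is_derive (0 : R) 1 (fun s : R => f (a + s *: w)) d ->
  is_derive a w f d.
Proof.
have e : (fun h : R => h^-1 *: (((fun s : R => f (a + s *: w)) \o shift 0) (h
  *: 1)
    - f (a + 0 *: w))) = fun h => h^-1 *: ((f \o shift a) (h *: w)
    - f a).
  apply/funext => h /=; congr (_ *: (f _ - f _)).
    by rewrite [_%:A]mulr1 addr0 addrC.
  by rewrite scale0r addr0.
move=> [df dfE]; apply: DeriveDef; first by rewrite /derivable -e.
by rewrite -dfE /derive e.
Qed.

Lemma is_derive_mulr (R : realType) (c t : R) :
  is_derive t (1 : R) (fun s : R => s * c) c.
Proof.
rewrite (_ : (fun s : R => s * c) = id * cst c)%R; last exact/funext.
by apply: is_derive_eq; rewrite scaler0 add0r /cst [LHS]mulr1.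
Qed.

Section ParametricIntegral.
Context (R : realType).
Local Notation mu := (@lebesgue_measure R).
Local Notation I01 := (`[0%R, 1%R]%classic : set R).

Lemma unit_itv_measure : mu I01 = 1%E.
Proof. by rewrite lebesgue_measure_itv /= lte_fin ltr01 oppr0 adde0. Qed.

Lemma unit_itv_integrable (f : R -> R) :
  {within I01, continuous f} -> mu.-integrable I01 (EFin \o f).
Proof. by apply: continuous_compact_integrable; exact: segment_compact. Qed.

Lemma continuous_within (f : R -> R) : 
  (forall t, 0 <= t <= 1 -> {for t, continuous f}) ->
    {within I01, continuous f}.
Proof.
move=> cf; apply: continuous_in_subspaceT => t; rewrite inE /= in_itv /=.
exact: cf.
Qed.

(* The near-covering form of compactness of [0, 1] makes the estimate uniform
   in t. *)
Lemma continuous_integral01 (T : topologicalType) (y0 : T) (f : T -> R -> R) :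
  (\forall y \near y0, forall t, 0 <= t <= 1 -> {for t, continuous (f y)}) ->
  (forall t : R, 0 <= t <= 1 -> f z.1 z.2 @[z --> (y0, t)] --> f y0 t) ->
  {for y0, continuous (fun y => \int[mu]_(t in I01) f y t)}.
Proof.
move=> cf jf; apply/cvgrPdist_le => /= e e0.
have int1 y : (forall t, 0 <= t <= 1 -> {for t, continuous (f y)}) ->
    mu.-integrable I01 (EFin \o f y).
  by move=> c; apply/unit_itv_integrable/continuous_within.
have cf0 : forall t, 0 <= t <= 1 -> {for t, continuous (f y0)}.
  exact: (nbhs_singleton cf).
have close : \forall y \near y0, I01 `<=` (fun t => `|f y0 t - f y t| <= e).
  move/compact_near_coveringP : (@segment_compact R 0 1); apply => t.
  rewrite /= in_itv /= => t01.
  have e2 : 0 < e / 2 by rewrite divr_gt0.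
  have /cvgrPdist_lt/(_ _ e2)[[U V] /= [U0 Vt] UV] := jf t t01.
  exists (V, U) => //= -[s y] /= [Vs Uy].
  have /= h1 := UV (y, s) (conj Uy Vs).
  have /= h2 := UV (y0, s) (conj (nbhs_singleton U0) Vs).
  rewrite (_ : _ - _ = (f y0 t - f y s) - (f y0 t - f y0 s)); last by ring.
  by rewrite (le_trans (ler_normB _ _)) // (splitr e) lerD // ltW.
near=> y.
have cy : forall t, 0 <= t <= 1 -> {for t, continuous (f y)} by near: y.
have cly : I01 `<=` (fun t => `|f y0 t - f y t| <= e) by near: y.
have cd : mu.-integrable I01 (EFin \o (fun t => f y0 t - f y t)).
  apply/unit_itv_integrable/continuous_within => t t01.
  by apply: continuousB; [exact: cf0 | exact: cy].
have cn : mu.-integrable I01 (EFin \o (fun t => `|f y0 t - f y t|)).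
  apply/unit_itv_integrable/continuous_within => t t01.
  by apply: continuous_comp; [apply: continuousB; [exact: cf0 | exact: cy]
    | exact: norm_continuous].
rewrite -RintegralB //; [|exact: int1|exact: int1].
apply: (le_trans (le_normr_Rintegral _ _)) => //.
apply: (le_trans (@le_Rintegral _ _ _ mu I01 _ (cst e) _ _ _ _)) => //.
- by apply/unit_itv_integrable/continuous_within => t _; exact: cst_continuous.
- by rewrite Rintegral_cst //= unit_itv_measure /= mulr1.
Unshelve. all: by end_near. Qed.

(** Differentiation under the integral needs a bound on [df] uniform near [a]; joint continuity at
    the points [(a, t)] and compactness of [0, 1] provide it. *)
Lemma is_derive_integral01 (f df : R -> R -> R) (a : R) :
  (\forall s \near a, forall t, 0 <= t <= 1 -> {for t, continuous (f s)}) ->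
  (\forall s \near a, forall t : R, 0 <= t <= 1 ->
    is_derive s (1 : R) (f^~ t) (df s t)) ->
  (forall t : R, 0 <= t <= 1 -> df z.1 z.2 @[z --> (a, t)] --> df a t) ->
  is_derive a (1 : R) (fun s => \int[mu]_(t in I01) f s t)
    (\int[mu]_(t in I01) df a t).
Proof.
move=> cf Df jf.
have cdf t : 0 <= t <= 1 -> {for t, continuous (df a)}.
  move=> t01; have as_cvg : (a, s) @[s --> t] --> (a, t).
    exact: (@cvg_pair _ _ _ _ (nbhs a) (nbhs t) _ _ _ (cst a) id (cvg_cst _)
      cvg_id).
  exact: (cvg_comp _ _ as_cvg (jf t t01)).
have [c c0 [M Mc]] : exists2 c, 0 < c &
    exists M, forall s t, `|a - s| < c -> 0 <= t <= 1 -> `|df s t| <= M.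
  have bd : bounded_set (df a @` I01).
    apply/compact_bounded/continuous_compact; last exact: segment_compact.
    exact: continuous_within.
  have [M [_ bM]] := bd.
  have close : \forall s \near a, I01 `<=` (fun t => `|df a t - df s t| <= 1).
    have /compact_near_coveringP nc := @segment_compact R 0 1.
    apply: (nc R (nbhs a) (fun s t => `|df a t - df s t| <= 1)) => t.
    rewrite /= in_itv /= => t01.
    have e2 : 0 < 1 / 2 :> R by rewrite divr_gt0.
    have [[U V] /= [U0 Vt] UV] : \forall z \near (a, t), `|df a t - df z.1 z.2|
      < 1 / 2.
      by have /cvgrPdist_lt := jf t t01; apply.
    exists (V, U) => //= -[s y] /= [Vs Uy].
    have /= h1 := UV (y, s) (conj Uy Vs).
    have /= h2 := UV (a, s) (conj (nbhs_singleton U0) Vs).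
    rewrite (_ : _ - _ = (df a t - df y s) - (df a t - df a s)); last by ring.
    by rewrite (le_trans (ler_normB _ _)) // [leRHS]splitr lerD // ltW.
  have /nbhs_ballP[c /= c0 cc] := close.
  (* [bounded_set] bounds [df a] by every number above [M], hence [M + 1]; the last 1 pays for
     passing from [df a t] to [df s t]. *)
  exists c => //; exists (M + 1 + 1) => s t sc t01.
  have h1 : `|df a t - df s t| <= 1 by apply: cc => //=; rewrite in_itv.
  have h2 : `|df a t| <= M + 1.
    by apply: bM; [rewrite ltrDl | exists t => //=; rewrite in_itv].
  rewrite (_ : df s t = df a t - (df a t - df s t)); last by ring.
  by rewrite (le_trans (ler_normB _ _)) // lerD.
have /nbhs_ballP[d /= d0 dd] : \forall s \near a,
    (forall t, 0 <= t <= 1 -> {for t, continuous (f s)}) /\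
    (forall t : R, 0 <= t <= 1 -> is_derive s (1 : R) (f^~ t) (df s t)).
  exact: filterI cf Df.
pose r := Num.min c d.
have r0 : 0 < r by rewrite lt_min c0.
have inr s : s \in `]a - r, a + r[ -> `|a - s| < c /\ `|a - s| < d.
  by rewrite in_itv /= -ltr_distl distrC lt_min => /andP.
have D1 s t : s \in `]a - r, a + r[ -> 0 <= t <= 1 -> 
    is_derive s (1 : R) (f^~ t) (df s t).
  by move=> /inr[_ sd] t01; apply: (dd s sd).2.
have M0 : 0 <= M.
  apply: le_trans (Mc a 0 _ _); rewrite ?normr_ge0 ?subrr ?normr0 //.
  by rewrite lexx ler01.
have aI : a \in `]a - r, a + r[ by rewrite in_itv /= ltrBlDr !ltrDl r0.
have key : {in I01, partial1of2 f a =1 df a}.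
  move=> t; rewrite inE /= in_itv /= => t01; rewrite partial1of2E.
  by have [_ ->] := D1 a t aI t01.
have intM : mu.-integrable I01 (EFin \o cst M).
  by apply/unit_itv_integrable/continuous_within => t _; exact: cst_continuous.
have intf x : `]a - r, a + r[%classic x -> mu.-integrable I01 (EFin \o f x).
  move=> /inr[_ sd]; apply/unit_itv_integrable/continuous_within.
  exact: (dd x sd).1.
have derf x t : `]a - r, a + r[%classic x -> I01 t -> derivable (f^~ t) x 1.
  by rewrite /= [t \in _]in_itv /= => xI t01; have [] := D1 x t xI t01.
have bdf x t : `]a - r, a + r[%classic x -> I01 t -> `|partial1of2 f x t| <= M.
  rewrite /= [t \in _]in_itv /= => xI t01; rewrite partial1of2E.
  have [_ ->] := D1 x t xI t01.
  by apply: Mc => //; have [] := inr _ xI.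
apply: DeriveDef.
  exact: (@derivable_under_integral R _ _ mu f I01 _ a _ _ aI intf derf (cst
    M)).
rewrite -derive1E (@differentiation_under_integral R _ _ mu f I01 _ a _ _ aI
  intf derf (cst M)) //.
exact: eq_Rintegral.
Qed.

End ParametricIntegral.

(** * Functions of class C^k and Hadamard's lemma *)

Section SmoothCalculus.
Context (R : realType) (n : nat).
Implicit Types (U V : set 'rV[R]_n) (f F : 'rV[R]_n -> R).
Local Notation mu := (@lebesgue_measure R).
Local Notation I01 := (`[0%R, 1%R]%classic : set R).
Local Notation e_ j := (delta_mx (0 : 'I_1) j : 'rV[R]_n).

Lemma Ck_sub k U V f : V `<=` U -> Ck k U f -> Ck k V f.
Proof.
move=> VU; elim: k f => [|k IH] f /= [cf Df]; split=> //.
- by move=> x /VU; exact: cf.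
- by move=> x /VU; exact: cf.
- by move=> i; have [d c] := Df i; split; [move=> x /VU; exact: d | exact: IH].
Qed.

Lemma Ck_local k U f :
  (forall x, U x -> exists2 V, V x & Ck k V f) -> Ck k U f.
Proof.
elim: k f => [|k IH] f H /=; split=> //.
- by move=> x /H[V Vx [cf _]]; exact: cf.
- by move=> x /H[V Vx [cf _]]; exact: cf.
- move=> i; split; first by move=> x /H[V Vx [_ /(_ i)[df _]]]; exact: df.
  by apply: IH => x /H[V Vx [_ /(_ i)[_ Df]]]; exists V.
Qed.

Lemma Ck_continuous k U f x : Ck k U f -> U x -> {for x, continuous f}.
Proof. by case: k => [|k] [cf _]; exact: cf. Qed.

Lemma ball_rowP (x y : 'rV[R]_n) r : 0 < r ->
  ball x r y <-> forall j, `|x 0 j - y 0 j| < r.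
Proof.
move=> r0; split=> [[_ h] j|h]; first exact: h.
by split=> // i j; rewrite (ord1 i); exact: h.
Qed.

Section Contraction.
Variables (x0 : 'rV[R]_n) (r : R) (lam : R -> 'I_n -> R).
Hypothesis r0 : 0 < r.
Hypothesis lam_cont : forall j, continuous (lam^~ j).
Hypothesis lam01 : forall t j, 0 <= t <= 1 -> 0 <= lam t j <= 1.

(** Each coordinate is contracted towards [x0] at its own rate, so one family covers all legs of a
    path parallel to the axes, and moving [y] along [e_ j] moves the image along [e_ j] only. *)
Definition contract (t : R) (y : 'rV[R]_n) : 'rV[R]_n :=
  \row_j (x0 0 j + lam t j * (y 0 j - x0 0 j)).

Lemma contract_ball t y : 0 <= t <= 1 -> ball x0 r y ->
  ball x0 r (contract t y).
Proof.
move=> /lam01 l01 /(ball_rowP _ _ r0) yB; apply/ball_rowP => // j.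
rewrite mxE opprD addNKr normrN normrM distrC.
have /andP[l0 l1] := l01 j; rewrite (ger0_norm l0).
by apply: le_lt_trans (yB j); rewrite ler_piMl.
Qed.

Lemma contract_cvg (y : 'rV[R]_n) (t : R) :
  contract z.2 z.1 @[z --> (y, t)] --> contract t y.
Proof.
apply: cvg_mx => i j; rewrite mxE.
under eq_fun do rewrite mxE.
have c1 : (z.1 : 'rV[R]_n) 0 j @[z --> (y, t)] --> y 0 j.
  by apply: (cvg_comp fst (fun y : 'rV[R]_n => y 0 j));
    [exact: cvg_fst | exact: coord_continuous].
have c2 : lam z.2 j @[z --> (y, t)] --> lam t j.
  by apply: (cvg_comp snd (lam^~ j)); [exact: cvg_snd | exact: lam_cont].
apply: cvgD; first exact: cvg_cst.
by apply: cvgM => //; apply: cvgB => //; exact: cvg_cst.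
Qed.

Lemma contract_line t y j s :
  contract t (y + s *: e_ j) = contract t y + (s * lam t j) *: e_ j.
Proof.
apply/rowP => i; rewrite !mxE eqxx /=.
by have [->|_] := eqVneq i j; rewrite ?mulr1 ?mulr0; ring.
Qed.

Variable m : R -> R.
Hypothesis m_cont : continuous m.

Lemma contract_joint_cvg F (y : 'rV[R]_n) (t : R) : 0 <= t <= 1 ->
  ball x0 r y ->
  (forall x, ball x0 r x -> {for x, continuous F}) ->
  m z.2 * F (contract z.2 z.1) @[z --> (y, t)] --> m t * F (contract t y).
Proof.
move=> t01 yB cF; apply: cvgM.
  by apply: (cvg_comp snd m); [exact: cvg_snd | exact: m_cont].
apply: (cvg_comp _ F); first exact: contract_cvg.
by apply: cF; exact: contract_ball.
Qed.

Lemma contract_cont F (y : 'rV[R]_n) (t : R) : 0 <= t <= 1 -> ball x0 r y ->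
  (forall x, ball x0 r x -> {for x, continuous F}) ->
  {for t, continuous (fun t => m t * F (contract t y))}.
Proof.
move=> t01 yB cF.
have yt : (y, s) @[s --> t] --> (y, t).
  exact: (@cvg_pair _ _ _ _ (nbhs y) (nbhs t) _ _ _ (cst y) id (cvg_cst _)
    cvg_id).
exact: (cvg_comp _ _ yt (contract_joint_cvg t01 yB cF)).
Qed.

End Contraction.

(** Differentiating in direction j under the integral replaces [m t] by [m t * lam t j] and [F] by a
    partial derivative, which gives an integral of the same shape; hence the induction over all
    weights [m]. *)
Lemma Ck_integral_contract x0 r (lam : R -> 'I_n -> R) (r0 : 0 < r)
    (lam_cont : forall j, continuous (lam^~ j))
    (lam01 : forall t j, 0 <= t <= 1 -> 0 <= lam t j <= 1) k :
  forall (m : R -> R) F, continuous m -> Ck k (ball x0 r) F ->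
  Ck k (ball x0 r) (fun y => \int[mu]_(t in I01) (m t * F (contract x0 lam t
    y))).
Proof.
have oB : open (ball x0 r) by exact: ball_open.
have contG (m : R -> R) F : continuous m ->
    (forall x, ball x0 r x -> {for x, continuous F}) -> forall x, ball x0 r x ->
    {for x, continuous (fun y => \int[mu]_(t in I01) (m t * F (contract x0 lam
      t y)))}.
  move=> cm cF x xB; apply: continuous_integral01.
    near=> y => t t01; apply: (contract_cont r0) => //.
    by near: y; apply: open_nbhs_nbhs; split.
  by move=> t t01; apply: (contract_joint_cvg r0).
elim: k => [|k IH] m F cm CF; split=> //.
- by apply: contG => //; have [cF _] := CF.
- by apply: contG => //; have [cF _] := CF.
move=> j; have [cF /(_ j)[dF CdF]] := CF.
have [cdF _] : Ck 0 (ball x0 r) (fun x => 'D_(e_ j) F x).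
  by split=> // x xB; exact: (Ck_continuous CdF).
have mlam : continuous (fun t => m t * lam t j).
  by move=> t; apply: cvgM; [exact: cm | exact: lam_cont].
have D x : ball x0 r x -> is_derive x (e_ j)
    (fun y => \int[mu]_(t in I01) (m t * F (contract x0 lam t y)))
    (\int[mu]_(t in I01) (m t * lam t j * 'D_(e_ j) F (contract x0 lam t x))).
  move=> xB; apply: is_derive_lineP.
  have lineB : \forall s \near (0 : R), ball x0 r (x + s *: e_ j).
    have lc : x + s *: e_ j @[s --> (0 : R)] --> x + 0 *: e_ j.
      by apply: cvgD; [exact: cvg_cst | apply: cvgZr_tmp; exact: cvg_id].
    apply: lc; rewrite scale0r addr0.
    by apply: open_nbhs_nbhs; split.
  rewrite (_ : (\int[mu]_(t in I01) (m t * lam t j * 'D_(e_ j) F (contract x0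
    lam t x))) =
    (\int[mu]_(t in I01) (m t * lam t j * 'D_(e_ j) F (contract x0 lam t (x + 0
      *: e_ j))))); last first.
    by rewrite scale0r addr0.
  apply: (is_derive_integral01 (f :=
    fun s t => m t * F (contract x0 lam t (x + s *: e_ j)))
    (df := fun s t => m t * lam t j * 'D_(e_ j) F (contract x0 lam t (x + s *:
      e_ j)))).
  - near=> s => t t01; apply: (contract_cont r0) => //.
    by near: s.
  - near=> s => t t01.
    have sB : ball x0 r (x + s *: e_ j) by near: s.
    have dl : derivable F (contract x0 lam t x + (s * lam t j) *: e_ j) (e_ j).
      by rewrite -contract_line; apply: dF; exact: contract_ball.
    have := @is_derive1_comp R (fun s => F (contract x0 lam t x + s *: e_ j))
      (fun s => s * lam t j) s _ _
      (is_derive_line dl) (is_derive_mulr _ _).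
    move=> /(@is_deriveZ _ _ _ _ (m t) _ _ _).
    rewrite -contract_line.
    have -> : m t *: ('D_(e_ j) F (contract x0 lam t (x + s *: e_ j)) * lam t
      j) =
      m t * lam t j * 'D_(e_ j) F (contract x0 lam t (x + s *: e_ j)).
      by rewrite [LHS]mulrA mulrAC.
    congr (is_derive _ _ _ _); apply/funext => u /=.
    by rewrite contract_line.
  - move=> t t01.
    have lc : (x + z.1 *: e_ j, z.2) @[z --> ((0 : R), t)] --> (x + 0 *: e_ j,
      t).
      apply: (@cvg_pair _ _ _ _ (nbhs (x + 0 *: e_ j)) (nbhs t));
        last exact: cvg_snd.
      by apply: cvgD; [exact: cvg_cst | apply: cvgZr_tmp; exact: cvg_fst].
    have x0B : ball x0 r (x + 0 *: e_ j) by rewrite scale0r addr0.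
    exact: (cvg_comp _ _ lc (contract_joint_cvg r0 lam_cont lam01 mlam t01 x0B
      cdF)).
split; first by move=> x xB; have [] := D x xB.
apply: (Ck_ext oB _ (IH _ _ mlam CdF)) => x xB.
by have [_ ->] := D x xB.
Unshelve. all: by end_near. Qed.

Lemma Ck_le k l U f : (k <= l)%N -> Ck l U f -> Ck k U f.
Proof.
elim: l => [|l IH]; first by rewrite leqn0 => /eqP ->.
rewrite leq_eqVlt => /predU1P[-> //|kl] Cf; apply: IH => //.
exact: CkS.
Qed.

Lemma derivable_continuous (f : R -> R) (t : R) : derivable f t 1 ->
  {for t, continuous f}.
Proof. by move=> /derivable1_diffP; exact: differentiable_continuous. Qed.

(** * Hadamard's lemma along paths parallel to the axes *)

Definition hadamard_weight (k : 'I_n) (t : R) (j : 'I_n) : R :=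
  if (j < k)%N then 1 else if j == k then t else 0.

(* Along the broken line from [x0] to [y] that changes one coordinate at a
   time, the k-th leg contributes [(y_k - x0_k) * hadamard_coef x0 F k y]. *)
Definition hadamard_coef (x0 : 'rV[R]_n) F (k : 'I_n) (y : 'rV[R]_n) : R :=
  \int[mu]_(t in I01) (cst 1 t * 'D_(e_ k) F (contract x0 (hadamard_weight k) t
    y)).

Lemma hadamard_weight_cont k j : continuous ((hadamard_weight k)^~ j).
Proof.
rewrite /hadamard_weight; case: (j < k)%N; first exact: cst_continuous.
by case: (j == k) => t; [exact: cvg_id | exact: cvg_cst].
Qed.

Lemma hadamard_weight01 k t j : 0 <= t <= 1 -> 0 <= hadamard_weight k t j <= 1.
Proof.
by rewrite /hadamard_weight; case: (j < k)%N; case: (j == k) => //;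
  rewrite ler01 lexx.
Qed.

Lemma hadamard_coef_Ck x0 r F k l : 0 < r -> Ck l.+1 (ball x0 r) F ->
  Ck l (ball x0 r) (hadamard_coef x0 F k).
Proof.
move=> r0 [_ /(_ k)[_ CF]].
have c1 : continuous (cst 1 : R -> R) by exact: cst_continuous.
rewrite /hadamard_coef.
have := Ck_integral_contract r0 (@hadamard_weight_cont k) (@hadamard_weight01
  k) c1 CF.
exact.
Qed.

Lemma hadamard_coef_base x0 F k : hadamard_coef x0 F k x0 = 'D_(e_ k) F x0.
Proof.
have e t : contract x0 (hadamard_weight k) t x0 = x0.
  by apply/rowP => j; rewrite mxE subrr mulr0 addr0.
rewrite /hadamard_coef; under eq_Rintegral do rewrite e mul1r.
by rewrite Rintegral_cst //= unit_itv_measure /= mulr1.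
Qed.

Lemma hadamardE x0 r F y : 0 < r -> Ck 1 (ball x0 r) F -> ball x0 r y ->
  F y = F x0 + \sum_(k < n) (y 0 k - x0 0 k) * hadamard_coef x0 F k y.
Proof.
move=> r0 [_ DF] yB.
(* [z m] is the m-th vertex of the broken line: the coordinates below [m] are already those of
   [y]. *)
pose z m := \row_(j < n) (if (j < m)%N then y 0 j else x0 0 j).
have zn : z n = y by apply/rowP => j; rewrite mxE ltn_ord.
have z0 : z 0%N = x0 by apply/rowP => j; rewrite mxE ltn0.
have -> : F y = F x0 + (F (z n) - F (z 0%N)) by rewrite zn z0 subrKC.
congr (_ + _).
rewrite -(@telescope_sumr _ 0%N n (fun k => F (z k))) ?leq0n // big_mkord.
apply: eq_bigr => k _; have [dF [cF _]] := DF k.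
set c := y 0 k - x0 0 k.
have ze t : contract x0 (hadamard_weight k) t y = z k + (t * c) *: e_ k.
  apply/rowP => j; rewrite !mxE /hadamard_weight eqxx /=.
  have [jk|kj] := ltnP j k.
    by rewrite (_ : j == k = false) ?mulr0; [ring | apply/eqP => jk';
      rewrite jk' ltnn in jk].
  by have [->|jk] := eqVneq j k; rewrite /c ?mulr1 ?mulr0; ring.
have zB t : 0 <= t <= 1 -> ball x0 r (z k + (t * c) *: e_ k).
  by move=> t01; rewrite -ze; apply: contract_ball => // *;
    exact: hadamard_weight01.
pose phi (t : R) := F (z k + (t * c) *: e_ k).
have Dphi (t : R) : 0 <= t <= 1 ->
  is_derive t (1 : R) phi (c * 'D_(e_ k) F (z k + (t * c) *: e_ k)).
  move=> t01; rewrite mulrC.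
  exact: (@is_derive1_comp R (fun s => F (z k + s *: e_ k)) (fun s => s * c) t
    _ _
      (is_derive_line (dF _ (zB t t01))) (is_derive_mulr _ _)).
have cphi (t : R) : 0 <= t <= 1 -> {for t, continuous phi}.
  by move=> t01; apply: derivable_continuous; have [] := Dphi t t01.
have cint : {within I01, continuous (fun t => c * 'D_(e_ k) F (z k + (t * c) *:
  e_ k))}.
  apply: continuous_within => t t01; apply: cvgM; first exact: cvg_cst.
  apply: (cvg_comp (fun t => z k + (t * c) *: e_ k) ('D_(e_ k) F)); last first.
    by apply: cF; exact: (zB t t01).
  apply: cvgD; first exact: cvg_cst.
  by apply: cvgZr_tmp; apply: cvgM; [exact: cvg_id | exact: cvg_cst].
have -> : z k.+1 = z k + (1 * c) *: e_ k.
  apply/rowP => j; rewrite !mxE eqxx ltnS leq_eqVlt mul1r /c /=.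
  have [->|jk] := eqVneq j k; first by rewrite eqxx ltnn /= mulr1; ring.
  by rewrite (_ : (j == k :> nat) = false) ?mulr0 ?addr0 //; exact/negbTE.
have e0 : z k = z k + (0 * c) *: e_ k by rewrite mul0r scale0r addr0.
have ftc : (\int[mu]_(t in I01) (c * 'D_(e_ k) F (z k + (t * c) *: e_ k))%:E
    = (phi 1)%:E - (phi 0)%:E)%E.
  apply: continuous_FTC2 => //.
    split.
    - move=> t; rewrite in_itv /= => /andP[t0 t1].
      by have [] := Dphi t; rewrite ?(ltW t0) ?(ltW t1).
    - by apply: cvg_at_right_filter; apply: cphi; rewrite lexx ler01.
    - by apply: cvg_at_left_filter; apply: cphi; rewrite lexx ler01.
  move=> t; rewrite in_itv /= => /andP[t0 t1]; rewrite derive1E.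
  by have [] := Dphi t; rewrite ?(ltW t0) ?(ltW t1).
rewrite {2}e0 -[LHS]/(fine ((phi 1)%:E - (phi 0)%:E)%E) -ftc.
rewrite -[LHS]/(\int[mu]_(t in I01) _)%R.
rewrite RintegralZl //; first by congr (_ * _); apply: eq_Rintegral => t _;
  rewrite ze mul1r.
apply/unit_itv_integrable; apply: continuous_within => t t01.
apply: (cvg_comp (fun t => z k + (t * c) *: e_ k) ('D_(e_ k) F)); last first.
  by apply: cF; exact: (zB t t01).
apply: cvgD; first exact: cvg_cst.
by apply: cvgZr_tmp; apply: cvgM; [exact: cvg_id | exact: cvg_cst].
Qed.

(** As [u] vanishes at [t], the difference quotient is (u(t + h) / h) w(t + h), so continuity of [w]
    is enough. In the chain rule [w] is a Hadamard coefficient along a curve. *)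
Lemma is_derive_mul_continuous (u w : R -> R) (t d : R) : u t = 0 ->
  is_derive t 1 u d -> {for t, continuous w} ->
  is_derive t 1 (fun s => u s * w s) (d * w t).
Proof.
move=> ut [du dE] cw.
have H : h^-1 *: (((fun s => u s * w s) \o shift t) (h *: 1) - u t * w t)
    @[h --> 0^'] --> d * w t.
  rewrite -dE; have -> : (fun h => h^-1 *: (((fun s => u s * w s) \o shift t)
    (h *: 1) - u t * w t))
    = (fun h => h^-1 *: ((u \o shift t) (h *: 1) - u t)) \* (fun h => w (h *: 1
      + t)).
    by apply/funext => h /=; rewrite ut mul0r !subr0 [RHS]mulrAC [LHS]mulrA
      mulrAC.
  apply: cvgM; first exact: du.
  apply: cvg_within_filter.
  have ht : h *: (1 : R) + t @[h --> (0 : R)] --> t.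
    have : h *: (1 : R) + t @[h --> (0 : R)] --> 0 *: (1 : R) + t.
      by apply: cvgD; [apply: cvgZr_tmp; exact: cvg_id | exact: cvg_cst].
    by rewrite scale0r add0r.
  exact: (cvg_comp _ w ht cw).
by apply: DeriveDef; [apply/cvg_ex; exists (d * w t) | apply/cvg_lim].
Qed.

(** Hadamard's lemma writes F(gam) - F(gam p) as a sum of terms (gam_k - gam_k(p)) h_k(gam), where
    h_k(gam p) is the k-th partial derivative of [F]; [is_derive_mul_continuous] differentiates each
    term without a total differential of [F]. *)
Lemma is_derive_comp_row (V : normedModType R) (gam : V -> 'rV[R]_n) (p v : V)
    (dg : 'I_n -> R) U F : open U -> U (gam p) -> Ck 1 U F ->
  (forall j, is_derive p v (fun q => gam q 0 j) (dg j)) ->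
  is_derive p v (F \o gam) (\sum_(j < n) dg j * 'D_(e_ j) F (gam p)).
Proof.
move=> oU Up CF Dg; apply: is_derive_lineP.
pose g (s : R) := gam (p + s *: v).
have g0 : g 0 = gam p by rewrite /g scale0r addr0.
have Dgj j : is_derive (0 : R) 1 (fun s => g s 0 j) (dg j).
  have [dj <-] := Dg j.
  have := @is_derive_line R V R (fun q => gam q 0 j) p v 0.
  by rewrite scale0r addr0; apply.
have cg : g s @[s --> (0 : R)] --> gam p.
  rewrite -g0; apply: cvg_mx => i j; rewrite (ord1 i).
  by apply: derivable_continuous; have [] := Dgj j.
have /nbhs_ballP[r /= r0 rU] : nbhs (gam p) U by apply: open_nbhs_nbhs.
have CFr : Ck 1 (ball (gam p) r) F := Ck_sub rU CF.
have gB : \forall s \near (0 : R), ball (gam p) r (g s).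
  exact: (cg _ (nbhsx_ballx (gam p) r r0)).
rewrite -/g; apply: (@near_eq_is_derive _ _ _ (cst (F (gam p)) +
    \sum_(k < n) (fun s => (g s 0 k - gam p 0 k) * hadamard_coef (gam p) F k (g
      s)))).
  near=> s.
  have sB : ball (gam p) r (g s) by near: s.
  rewrite -[RHS]/(F (g s)) (hadamardE r0 CFr sB).
  by rewrite -[LHS]/(_ + _) /cst fct_sumE.
rewrite -[X in is_derive _ _ _ X]add0r; apply: is_deriveD.
apply: is_derive_sum => k; rewrite -hadamard_coef_base -g0.
apply: is_derive_mul_continuous; first by rewrite subrr.
  rewrite -[dg k]subr0; apply: is_deriveB; exact: Dgj.
have cg0 : g s @[s --> (0 : R)] --> g 0 by rewrite g0.
apply: (cvg_comp _ (hadamard_coef (g 0) F k) cg0).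
rewrite g0; apply: (Ck_continuous (hadamard_coef_Ck k r0 CFr)).
exact: ballxx.
Unshelve. all: by end_near. Qed.

Lemma Ck_sum k U (I : Type) (s : seq I) (f : I -> 'rV[R]_n -> R) : open U ->
  (forall i, Ck k U (f i)) -> Ck k U (fun x => \sum_(i <- s) f i x).
Proof.
move=> oU Cf; elim: s => [|i s IH].
  by apply: (Ck_ext oU _ (Ck_cst oU k 0)) => x _; rewrite big_nil.
by apply: (Ck_ext oU _ (CkD oU (Cf i) IH)) => x _; rewrite big_cons.
Qed.

End SmoothCalculus.

Lemma continuous_row (T : topologicalType) (R : numFieldType) n
    (f : T -> 'rV[R]_n) (x : T) :
  (forall j, {for x, continuous (fun y => f y 0 j)}) -> {for x, continuous f}.
Proof.
move=> cf; apply: (@cvg_mx T (nbhs x) R 1 n f (f x)) => i j.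
rewrite (ord1 i); exact: cf.
Qed.

Lemma Ck_comp (R : realType) (m n k : nat) (W : set 'rV[R]_m) (U : set 'rV[R]_n)
    (tau : 'rV[R]_m -> 'rV[R]_n) (F : 'rV[R]_n -> R) :
  open W -> open U -> (forall x, W x -> U (tau x)) ->
  (forall j, Ck k W (fun x => tau x 0 j)) -> Ck k U F -> Ck k W (F \o tau).
Proof.
move=> oW oU WU; elim: k F => [|k IH] F Ct CF.
  split=> // x Wx; apply: continuous_comp.
    by apply: continuous_row => j; exact: (Ck_continuous (Ct j)).
  by apply: (Ck_continuous CF); exact: WU.
split.
  move=> x Wx; apply: continuous_comp.
    by apply: continuous_row => j; exact: (Ck_continuous (Ct j)).
  by apply: (Ck_continuous CF); exact: WU.
move=> i.
have D x : W x -> is_derive x (delta_mx 0 i) (F \o tau) (\sum_(j < n)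
    'D_(delta_mx 0 i) (fun y => tau y 0 j) x * 'D_(delta_mx 0 j) F (tau x)).
  move=> Wx; apply: (is_derive_comp_row oU) => //; first exact: WU.
    exact: (Ck_le _ CF).
  by move=> j; have [_ /(_ i)[dt _]] := Ct j; apply/derivableP/dt.
split; first by move=> x Wx; have [] := D x Wx.
have Ct' j : Ck k W (fun x => tau x 0 j) by exact: CkS.
apply: (@Ck_ext _ _ _ oW k _ _ _ (@Ck_sum R m k W 'I_n (index_enum _)
   (fun j => (fun x => 'D_(delta_mx 0 i) (fun y => tau y 0 j) x) \*
     ('D_(delta_mx 0 j) F \o tau)) oW _)).
  by move=> x Wx; have [_ ->] := D x Wx.
move=> j; apply: CkM => //; first by have [_ /(_ i)[]] := Ct j.
by apply: IH => //; have [_ /(_ j)[]] := CF.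
Qed.

(** * Bump functions *)

Section Bump.
Context (R : realType).

(** The functions P(1/t) exp(-1/t), extended by 0, are closed under differentiation, [P] becoming (P
    - P') X^2. With [P] as a parameter, smoothness at 0 is a plain induction. *)
Definition flat (P : {poly R}) (t : R) : R :=
  if 0 < t then P.[t^-1] * expR (- t^-1) else 0.

Lemma flat_le0 P t : t <= 0 -> flat P t = 0.
Proof. by rewrite /flat ltNge => ->. Qed.

Lemma flat1_gt0 t : 0 < t -> 0 < flat 1 t.
Proof. by move=> t0; rewrite /flat t0 hornerC mul1r expR_gt0. Qed.

Lemma flat1_ge0 t : 0 <= flat 1 t.
Proof.
by have [/flat_le0 -> //|/flat1_gt0/ltW] := leP t 0.
Qed.

(* From exp x = (exp (x / k))^k >= (x / k)^k. *)
Lemma expr_expRN_le (k : nat) (x : R) : 0 <= x ->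
  x ^+ k * expR (- x) <= k%:R ^+ k.
Proof.
move=> x0; case: k => [|k].
  by rewrite !expr0 mul1r -expR0 ler_expR oppr_le0.
have k0 : 0 < k.+1%:R :> R by rewrite ltr0n.
rewrite expRN ler_pdivrMr ?expR_gt0 //.
have -> : expR x = expR (x / k.+1%:R) ^+ k.+1.
  by rewrite -expRM_natl; congr expR; rewrite mulrC divfK // gt_eqF.
have -> : x ^+ k.+1 = k.+1%:R ^+ k.+1 * (x / k.+1%:R) ^+ k.+1.
  by rewrite -exprMn [x / _]mulrC mulVKf // gt_eqF.
apply: ler_wpM2l; first by rewrite exprn_ge0 // ltW.
apply: lerXn2r; rewrite ?nnegrE ?divr_ge0 ?expR_ge0 // ?(ltW k0) //.
by apply: le_trans (expR_ge1Dx _); rewrite lerDr.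
Qed.

Lemma flat_bounded P : exists2 C, 0 <= C & forall t, `|flat P t| <= C.
Proof.
exists (\sum_(i < size P) `|P`_i| * i%:R ^+ i).
  by apply: sumr_ge0 => i _; rewrite mulr_ge0 // exprn_ge0.
move=> t; rewrite /flat; case: ifPn => t0; last first.
  by rewrite normr0; apply: sumr_ge0 => i _; rewrite mulr_ge0 // exprn_ge0.
rewrite horner_coef mulr_suml; apply: le_trans (ler_norm_sum _ _ _) _.
apply: ler_sum => i _; rewrite -mulrA normrM; apply: ler_wpM2l => //.
rewrite ger0_norm ?mulr_ge0 ?expR_ge0 ?exprn_ge0 ?invr_ge0 ?(ltW t0) //.
by apply: expr_expRN_le; rewrite invr_ge0 ltW.
Qed.

(** Hence [flat P] is t times a bounded function and tends to 0 at 0, and its difference quotient at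
    0 is [flat (P * 'X)], which tends to 0 as well. *)
Lemma flatMX P t : flat P t = t * flat (P * 'X) t.
Proof.
rewrite /flat; case: ifPn => t0; last by rewrite mulr0.
rewrite hornerMX; set E := expR _; set p := P.[_].
by rewrite -[LHS]mul1r -(mulfV (lt0r_neq0 t0)); ring.
Qed.

Lemma flat_cvg0 P : flat P h @[h --> (0 : R)] --> (0 : R).
Proof.
have [C C0 HC] := flat_bounded (P * 'X).
apply/cvgrPdist_le => /= e e0.
have hb : \forall h \near (0 : R), `|h| <= e / (C + 1).
  exists (e / (C + 1)); first by rewrite /= divr_gt0 // ltr_wpDl.
  by move=> h; rewrite /= sub0r normrN => /ltW.
near=> h; rewrite sub0r normrN flatMX normrM.
apply: (@le_trans _ _ (`|h| * (C + 1))).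
  by apply: ler_wpM2l => //; apply: le_trans (HC h) _; rewrite lerDl.
rewrite -ler_pdivlMr ?ltr_wpDl //.
by near: h.
Unshelve. all: by end_near. Qed.

Lemma is_derive_flat P (t : R) :
  is_derive t (1 : R) (flat P) (flat ((P - P^`()) * 'X^2) t).
Proof.
have [t0|t0|->] := ltgtP t 0.
- rewrite (flat_le0 _ (ltW t0)).
  apply: (@near_eq_is_derive _ _ _ (cst 0)).
  by apply: filterS (lt_nbhsl t0) => s s0; rewrite flat_le0 // ltW.
- pose h (x : R) := P.[x] * expR (- x).
  have Dh x : is_derive x (1 : R) h ((P^`() - P).[x] * expR (- x)).
    have Dp : is_derive x (1 : R) (horner P) (P^`()).[x].
      apply: DeriveDef; first exact: derivable_horner.
      by rewrite -derive1E derivE.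
    have De : is_derive x (1 : R) (fun x : R => expR (- x)) (- expR (- x)).
      have Dn : is_derive x (1 : R) (fun x : R => - x) (- 1).
        exact: is_deriveN.
      have := @is_derive1_comp R expR (fun x : R => - x) x _ _ (is_derive_expR
        _) Dn.
      by rewrite mulrN1.
    apply: (@is_derive_eq _ _ _ h x 1 _ _ (is_deriveM Dp De)).
    rewrite hornerD hornerN -![_ *: _]/(_ * _); ring.
  have Dv : is_derive t (1 : R) (fun s : R => s^-1) (- t ^- 2).
    have := @is_deriveV R id t 1 1 _ _; rewrite gt_eqF // => /(_ isT _).
    by rewrite -[_ *: 1]/(_ * 1) mulr1; apply.
  have := is_derive1_comp (Dh t^-1) Dv.
  rewrite /flat t0 hornerM hornerXn hornerD hornerN hornerD hornerN => H.
  apply: (near_eq_is_derive _ (is_derive_eq H _)); last by rewrite exprVn; ring.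
  by apply: filterS (lt_nbhsr t0) => s s0; rewrite /= /h /flat s0.
- rewrite flat_le0 //.
  have H : h^-1 *: ((flat P \o shift 0) (h *: (1 : R)) - flat P 0)
      @[h --> (0 : R)^'] --> (0 : R).
    apply: (@cvg_trans _ (flat (P * 'X) @ (0 : R)^')); last first.
      by apply: cvg_within_filter; exact: flat_cvg0.
    apply: near_eq_cvg; near=> h.
    have h0 : h != 0 by near: h; exact: nbhs_dnbhs_neq.
    rewrite /= addr0 [_ *: 1]mulr1 (flat_le0 _ (lexx 0)) subr0 [in RHS]flatMX.
    by rewrite [RHS]mulrA mulVf // mul1r.
  by apply: DeriveDef; [apply/cvg_ex; exists 0 | apply/cvg_lim].
Unshelve. all: by end_near. Qed.

Lemma Ck_flat n (U : set 'rV[R]_n) k : open U -> forall P (f : 'rV[R]_n -> R),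
  Ck k U f -> Ck k U (flat P \o f).
Proof.
move=> oU; elim: k => [|k IH] P f /=.
  move=> [cf _]; split=> // x Ux; apply: continuous_comp; first exact: cf.
  by apply: derivable_continuous; have [] := is_derive_flat P (f x).
move=> /[dup] /CkS kf [cf Df].
have cflat x : U x -> {for x, continuous (flat P \o f)}.
  move=> Ux; apply: continuous_comp; first exact: cf.
  by apply: derivable_continuous; have [] := is_derive_flat P (f x).
split=> // i; have [df CDf] := Df i.
set v := delta_mx 0 i.
have D x : U x -> is_derive x v (flat P \o f)
    (flat ((P - P^`()) * 'X^2) (f x) * 'D_v f x).
  move=> Ux; apply: is_derive_lineP.
  have := @is_derive_line R _ _ f x v 0;
    rewrite scale0r addr0 => /(_ (df x Ux)) Dl.
  have Dfl : is_derive (f (x + 0 *: v)) (1 : R) (flat P) (flat ((P - P^`()) *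
    'X^2) (f x)).
    by rewrite scale0r addr0; exact: is_derive_flat.
  exact: (@is_derive1_comp R (flat P) (fun s => f (x + s *: v)) 0 _ _ Dfl Dl).
split; first by move=> x Ux; have [] := D x Ux.
apply: (Ck_ext oU _ (CkM oU (IH ((P - P^`()) * 'X^2) f kf) CDf)) => x Ux.
by have [_ ->] := D x Ux.
Qed.

Lemma derive_coord n (x : 'rV[R]_n) i j :
  is_derive x (delta_mx 0 i) (fun y : 'rV[R]_n => y 0 j) ((j == i)%:R : R).
Proof.
apply: is_derive_lineP.
have -> : (fun s : R => (x + s *: delta_mx 0 i) 0 j) =
    (cst (x 0 j) + id * cst ((j == i)%:R : R))%R.
  by apply/funext => s; rewrite !mxE eqxx.
by apply: is_derive_eq; rewrite scaler0 !add0r /cst [LHS]mulr1.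
Qed.

Lemma Ck_coord n k (U : set 'rV[R]_n) (j : 'I_n) : open U ->
  Ck k U (fun y : 'rV[R]_n => y 0 j).
Proof.
move=> oU; case: k => [|k] /=; split=> //; try by move=> x _;
  exact: coord_continuous.
move=> i; split; first by move=> x _; have [] := derive_coord x i j.
apply: (Ck_ext oU _ (Ck_cst oU k ((j == i)%:R : R))) => x Ux.
by have [_ ->] := derive_coord x i j.
Qed.

Lemma Ck_prod n k (U : set 'rV[R]_n) (I : Type) (s : seq I) (f : I ->
  'rV[R]_n -> R) :
  open U -> (forall i, Ck k U (f i)) -> Ck k U (fun x => \prod_(i <- s) f i x).
Proof.
move=> oU Cf; elim: s => [|i s IH].
  by apply: (Ck_ext oU _ (Ck_cst oU k 1)) => x _; rewrite big_nil.
by apply: (Ck_ext oU _ (CkM oU (Cf i) IH)) => x _; rewrite big_cons.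
Qed.

(** Balls of row vectors are cubes, so for [r] > 0 this product of one-variable cut-offs is positive
    exactly on the ball of radius [r]. *)
Definition bump n (x0 : 'rV[R]_n) (r : R) (x : 'rV[R]_n) : R :=
  \prod_(j < n) (flat 1 (r - (x 0 j - x0 0 j)) * flat 1 (r + (x 0 j - x0 0 j))).

Lemma Ck_bump n k (U : set 'rV[R]_n) x0 r : open U -> Ck k U (bump x0 r).
Proof.
move=> oU; apply: Ck_prod => // j.
have Ca a b : Ck k U (fun y : 'rV[R]_n => a + b * (y 0 j - x0 0 j)).
  apply: (CkD oU (Ck_cst oU k a)); apply: (CkM oU (Ck_cst oU k b)).
  exact: (CkD oU (Ck_coord k j oU) (Ck_cst oU k (- x0 0 j))).
apply: CkM => //.
  apply: (@Ck_flat n U k oU 1 (fun x => r - (x 0 j - x0 0 j))).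
  by apply: (Ck_ext oU _ (Ca r (-1))) => x _; rewrite mulN1r.
apply: (@Ck_flat n U k oU 1 (fun x => r + (x 0 j - x0 0 j))).
by apply: (Ck_ext oU _ (Ca r 1)) => x _; rewrite mul1r.
Qed.

Lemma bump_ge0 n (x0 : 'rV[R]_n) r x : 0 <= bump x0 r x.
Proof. by apply: prodr_ge0 => j _; rewrite mulr_ge0 // flat1_ge0. Qed.

Lemma bump_gt0 n (x0 : 'rV[R]_n) r x : ball x0 r x -> 0 < bump x0 r x.
Proof.
move=> [_ xB]; apply: prodr_gt0 => j _; have := xB 0 j.
rewrite /ball /= ltr_norml => /andP[h1 h2].
by rewrite mulr_gt0 // flat1_gt0 //; lra.
Qed.

Lemma bump_gt0P n (x0 : 'rV[R]_n) r x : 0 < r -> 0 < bump x0 r x -> ball x0 r x.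
Proof.
move=> r0; apply: contraTP => /= nB.
have [j] : exists j, ~ (`|x0 0 j - x 0 j| < r).
  by apply/existsNP => H; apply: nB; apply/ball_rowP.
move=> /negP; rewrite -leNgt => rj.
rewrite /bump (bigD1 j) //=.
suff -> : flat 1 (r - (x 0 j - x0 0 j)) * flat 1 (r + (x 0 j - x0 0 j)) = 0.
  by rewrite mul0r ltxx.
move: rj; rewrite ler_normr => /orP[h|h].
  by rewrite [X in _ * X]flat_le0 ?mulr0 //; lra.
by rewrite [X in X * _]flat_le0 ?mul0r //; lra.
Qed.

End Bump.

(** * Charts and derivations *)

Section ClosedBox.
Context (R : realType) (n : nat).

Definition box (x0 : 'rV[R]_n) (r : R) : set 'rV[R]_n :=
  [set x | forall j, `|x0 0 j - x 0 j| <= r].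

Lemma box_compact x0 r : compact (box x0 r).
Proof.
have := @rV_compact R n (fun j => `[x0 0 j - r, x0 0 j + r]%classic)
  (fun j => @segment_compact R _ _).
congr (compact _); apply/seteqP; split=> x /= H j; have := H j;
  by rewrite /= in_itv /= distrC ler_distl.
Qed.

Lemma box_closed x0 r : closed (box x0 r).
Proof. by apply: compact_closed;
  [exact: norm_hausdorff | exact: box_compact]. Qed.

Lemma ball_box x0 r : ball x0 r `<=` box x0 r.
Proof. by move=> x [_ H] j; apply: ltW; exact: H. Qed.

Lemma box_ball x0 r r' : 0 < r -> r < r' -> box x0 r `<=` ball x0 r'.
Proof.
move=> r0 rr x H; apply/ball_rowP; first exact: lt_trans rr.
by move=> j; apply: le_lt_trans (H j) rr.
Qed.

(** The arbitrary values of [F] off [V] are harmless: the bump vanishes off the box, and [V]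
    together with the complement of the closed box covers the space. *)
Lemma Ck_bump_mul k V x0 r (F : 'rV[R]_n -> R) : 0 < r -> open V ->
  box x0 r `<=` V -> Ck k V F -> Ck k setT (bump x0 r \* F).
Proof.
move=> r0 oV KV CF; apply: Ck_local => x _.
have [xK|xK] := pselect (box x0 r x).
  by exists V; [exact: KV | apply: CkM => //; exact: Ck_bump].
exists (~` box x0 r) => //.
have oK : open (~` box x0 r) by apply: closed_openC; exact: box_closed.
apply: (Ck_ext oK _ (Ck_cst oK k 0)) => y yK /=.
have [b0|b0] := ltP 0 (bump x0 r y); last first.
  by rewrite (le_anti (introT andP (conj b0 (bump_ge0 x0 r y)))) mul0r.
by exfalso; apply: yK; apply: ball_box; exact: bump_gt0P.
Qed.

End ClosedBox.

Section Charts.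
Context (R : realType) (n : nat) (M : topologicalType) (A : atlas R n M).
Hypothesis hausdorffM : hausdorff_space M.
Implicit Types (f h : smooth_fun A) (X Y : vfield A).

Local Notation dom := (chart_dom A).
Local Notation fwd := (chart_fwd A).
Local Notation inv := (chart_inv A).
Local Notation img i := (chart_fwd A i @` chart_dom A i).
Local Notation e_ j := (delta_mx (0 : 'I_1) j : 'rV[R]_n).

Lemma img_open i : open (img i). Proof. exact: chart_img_open. Qed.

Lemma inv_dom i x : img i x -> dom i (inv i x).
Proof. by move=> [p pi <-]; rewrite chart_fwdK. Qed.

Lemma invK i x : img i x -> fwd i (inv i x) = x.
Proof. by move=> [p pi <-]; rewrite chart_fwdK. Qed.

Lemma fwd_img i p : dom i p -> img i (fwd i p).
Proof. by exists p. Qed.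

Lemma smooth_chart f i k : Ck k (img i) (f \o inv i).
Proof. by have /asboolP := smooth_funP f; apply. Qed.

Lemma smooth_continuous f : continuous f.
Proof.
move=> p; have [i pi] := chart_cover A p.
have c : {for p, continuous ((f \o inv i) \o fwd i)}.
  apply: continuous_comp; first exact: chart_fwd_continuous.
  by apply: (Ck_continuous (smooth_chart f i 0)); exact: fwd_img.
have e : {near p, (f \o inv i) \o fwd i =1 f}.
  have : nbhs p (dom i) by apply: open_nbhs_nbhs; split => //;
    exact: chart_dom_open.
  by apply: filterS => q qi /=; rewrite chart_fwdK.
rewrite /continuous_at -[f p](nbhs_singleton e).
exact: (cvg_trans (@near_eq_cvg _ _ (nbhs p) _ ((f \o inv i) \o fwd i) f e) c).
Qed.

Lemma overlap_open i j : open (fwd j @` (dom j `&` dom i)).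
Proof.
rewrite openE => y [p [pj pi] <-].
have yj : img j (fwd j p) by exact: fwd_img.
have n1 : nbhs (fwd j p) (img j) by apply: open_nbhs_nbhs; split => //;
  exact: img_open.
have n2 : nbhs (fwd j p) (inv j @^-1` dom i).
  apply: (chart_inv_continuous yj); rewrite chart_fwdK //.
  by apply: open_nbhs_nbhs; split => //; exact: chart_dom_open.
apply: filterS (filterI n1 n2) => z [zj zi]; exists (inv j z); last exact: invK.
by split => //; exact: inv_dom.
Qed.

Definition cut i x0 r (F : 'rV[R]_n -> R) (q : M) : R :=
  if `[< dom i q >] then bump x0 r (fwd i q) * F (fwd i q) else 0.

Lemma cut_dom i x0 r F q : dom i q ->
  cut i x0 r F q = bump x0 r (fwd i q) * F (fwd i q).
Proof. by move=> qi; rewrite /cut asboolT. Qed.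

(** At points of [dom i] the transition maps carry smoothness over. At the others, the image in [M]
    of the compact box is closed because [M] is Hausdorff, and [cut] vanishes on its complement. *)
Lemma cut_smooth i x0 r V F : 0 < r -> box x0 r `<=` img i -> open V ->
  box x0 r `<=` V -> smooth_on V F -> smooth A (cut i x0 r F).
Proof.
move=> r0 Ki oV KV sF j k; apply: Ck_local => y yj.
have CT : Ck k setT (bump x0 r \* F) by exact: Ck_bump_mul (sF k).
have [pi|npi] := pselect (dom i (inv j y)).
  exists (fwd j @` (dom j `&` dom i)).
    by exists (inv j y); [split => //; exact: inv_dom | exact: invK].
  have oW := @overlap_open i j.
  have tr (l : 'I_n) := @chart_transition _ _ _ A j i l k.
  apply: (Ck_ext oW _ (Ck_comp oW openT (fun _ _ => I) tr CT)) => z [q [qj qi]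
    <-] /=.
  by rewrite chart_fwdK // cut_dom.
pose C := inv i @` box x0 r.
have cC : closed C.
  apply: compact_closed => //; apply: continuous_compact;
    last exact: box_compact.
  apply: continuous_in_subspaceT => x; rewrite inE => xK.
  by apply: chart_inv_continuous; exact: Ki.
have nC : nbhs y (inv j @^-1` ~` C).
  apply: (chart_inv_continuous yj); apply: open_nbhs_nbhs; split.
    exact: closed_openC.
  by move=> [x xK xE]; apply: npi; rewrite -xE; apply: inv_dom; exact: Ki.
have nj : nbhs y (img j) by apply: open_nbhs_nbhs; split => //; exact: img_open.
exists ((img j `&` inv j @^-1` ~` C)^°); first exact: filterI.
have oW : open ((img j `&` inv j @^-1` ~` C)^°) by exact: open_interior.
apply: (Ck_ext oW _ (Ck_cst oW k 0)) => z /interior_subset[zj zC] /=.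
rewrite /cut; case: asboolP => // zi.
have [b0|b0] := ltP 0 (bump x0 r (fwd i (inv j z))); last first.
  by rewrite (le_anti (introT andP (conj b0 (bump_ge0 x0 r _)))) mul0r.
exfalso; apply: zC; exists (fwd i (inv j z)); last by rewrite chart_fwdK.
by apply: ball_box; exact: bump_gt0P.
Qed.

Definition mk_smooth (f : M -> R) (sf : smooth A f) : smooth_fun A :=
  SmoothFun (introT (asboolP _) sf).

Lemma smoothDE f h q : (f + h) q = f q + h q. Proof. by []. Qed.
Lemma smoothME f h q : (f * h) q = f q * h q. Proof. by []. Qed.
Lemma smooth0E q : (0 : smooth_fun A) q = 0. Proof. by []. Qed.
Lemma smooth_ext f h : (forall q, f q = h q) -> f = h.
Proof. by move=> fh; apply: val_inj; apply/funext. Qed.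

Lemma smooth_sumE (I : Type) (s : seq I) (F : I -> smooth_fun A) q :
  (\sum_(i <- s) F i) q = \sum_(i <- s) F i q.
Proof. by elim: s => [|i s IH]; rewrite ?big_nil // !big_cons -IH. Qed.

Lemma vfieldM X f h : X (f * h) = f * X h + X f * h.
Proof. by have /asboolP[_] := vfieldP X; apply. Qed.

Lemma smooth_cst1 : smooth_cst A 1 = 1.
Proof. exact: smooth_ext. Qed.

Lemma vfieldD X f h : X (f + h) = X f + X h.
Proof.
have /asboolP[/(_ 1 f h) + _] := vfieldP X.
by rewrite smooth_cst1 !mul1r.
Qed.

Lemma vfield0 X : X 0 = 0.
Proof. by apply: (addrI (X 0)); rewrite -vfieldD !addr0. Qed.

Lemma vfield_cst X a : X (smooth_cst A a) = 0.
Proof.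
have X1 : X 1 = 0.
  have := vfieldM X 1 1; rewrite !mul1r mulr1 => h.
  by apply: (addrI (X 1)); rewrite -h addr0.
have /asboolP[/(_ a 1 0) + _] := vfieldP X.
by rewrite mulr1 !addr0 X1 vfield0 mulr0 addr0.
Qed.

Lemma vfieldN X f : X (- f) = - X f.
Proof. by apply: (addrI (X f)); rewrite -vfieldD !subrr vfield0. Qed.

Lemma vfield_sum X (I : Type) (s : seq I) (F : I -> smooth_fun A) :
  X (\sum_(i <- s) F i) = \sum_(i <- s) X (F i).
Proof.
elim: s => [|i s IH]; first by rewrite !big_nil vfield0.
by rewrite !big_cons vfieldD IH.
Qed.

Lemma vfield_sumE (I : Type) (s : seq I) (F : I -> vfield A) f :
  (\sum_(i <- s) F i) f = \sum_(i <- s) F i f.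
Proof. by elim: s => [|i s IH]; rewrite ?big_nil // !big_cons -IH. Qed.

Lemma vfield_ext X Y : (forall f q, X f q = Y f q) -> X = Y.
Proof.
by move=> XY; apply: val_inj; apply/funext => f; apply: smooth_ext => q;
  exact: XY.
Qed.

(** The box carries the support of a bump function; the larger ball, still in the chart image, is
    where Hadamard's lemma is applied. *)
Lemma box_chart i p : dom i p -> exists2 r, 0 < r &
  exists2 r', box (fwd i p) r `<=` ball (fwd i p) r' &
    0 < r' /\ ball (fwd i p) r' `<=` img i.
Proof.
move=> pi; have : nbhs (fwd i p) (img i).
  by apply: open_nbhs_nbhs; split; [exact: img_open | exact: fwd_img].
move=> /nbhs_ballP[r' /= r0 rU]; exists (r' / 2); first by rewrite divr_gt0.
exists r' => //; apply: box_ball; rewrite ?divr_gt0 //.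
by rewrite ltr_pdivrMr // ltr_pMr // ltr1n.
Qed.

(* With F = f \o inv, Hadamard's decomposition of F around x0, multiplied by
   the square of a bump function, becomes an identity between global smooth
   functions, to which X applies. *)
Lemma vfield_at X i p : dom i p -> exists c : 'I_n -> R, forall f,
  X f p = \sum_(k < n) c k * 'D_(e_ k) (f \o inv i) (fwd i p).
Proof.
move=> pi; have [r r0 [r' Kr' [r'0 r'i]]] := box_chart pi.
set x0 := fwd i p in Kr' r'i *.
have Ki := subset_trans Kr' r'i.
have sm F : smooth_on (ball x0 r') F -> smooth A (cut i x0 r F).
  by move=> sF; apply: (@cut_smooth i x0 r (ball x0 r')) => //;
    exact: ball_open.
have oB : open (ball x0 r') by exact: ball_open.
have s1 : smooth_on (ball x0 r') (cst 1) by move=> k; exact: Ck_cst.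
have sx j : smooth_on (ball x0 r') (fun x => x 0 j - x0 0 j).
  by move=> k; exact: (CkD oB (Ck_coord k j oB) (Ck_cst oB k (- x0 0 j))).
pose sg := mk_smooth (sm _ s1); pose xi j := mk_smooth (sm _ (sx j)).
have sgp : sg p = bump x0 r x0 by rewrite /sg /= cut_dom // mulr1.
have b0 : 0 < bump x0 r x0 by apply: bump_gt0; exact: ballxx.
(* [xi j] is the bump times the j-th coordinate centred at [p], so this quotient is the value that
   [X] would give to the coordinate itself. *)
exists (fun j => X (xi j) p / bump x0 r x0) => f.
set F := f \o inv i.
have CF k : Ck k (ball x0 r') F by apply: Ck_sub r'i _; exact: smooth_chart.
have sG j : smooth_on (ball x0 r') (hadamard_coef x0 F j).
  by move=> k; exact: hadamard_coef_Ck.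
pose Ga j := mk_smooth (sm _ (sG j)).
have E : sg * sg * f = sg * sg * smooth_cst A (f p) + \sum_j xi j * Ga j.
  apply: smooth_ext => q.
  rewrite smoothDE !smoothME smooth_sumE; under eq_bigr do rewrite smoothME.
  rewrite /=.
  have [qi|nqi] := pselect (dom i q); last first.
    rewrite /cut asboolF // !mul0r add0r big1 // => j _; exact: mul0r.
  rewrite !cut_dom //; under eq_bigr do rewrite !cut_dom //.
  have [qB|qB] := pselect (ball x0 r' (fwd i q)); last first.
    have -> : bump x0 r (fwd i q) = 0.
      apply: le_anti; rewrite bump_ge0 andbT leNgt;
        apply/negP => /(bump_gt0P r0).
      by move=> /ball_box/Kr'.
    by rewrite !mul0r add0r big1 // => j _; rewrite !mul0r.
  have := hadamardE r'0 (CF 1%N) qB; rewrite /F /= !chart_fwdK // => ->.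
  rewrite /cst !mulr1 mulrDr; congr (_ + _).
  by rewrite mulr_sumr; apply: eq_bigr => j _; ring.
have xip j : xi j p = 0 by rewrite /xi /= cut_dom // subrr mulr0.
have Gap j : Ga j p = bump x0 r x0 * 'D_(e_ j) F x0.
  by rewrite /Ga /= cut_dom // hadamard_coef_base.
have Xt j : X (xi j * Ga j) p = X (xi j) p * (bump x0 r x0 * 'D_(e_ j) F x0).
  by rewrite vfieldM smoothDE !smoothME xip mul0r add0r Gap mulrC.
have := congr1 (fun h : smooth_fun A => h p) (congr1 X E).
rewrite /= vfieldD !vfieldM vfield_cst vfield_sum !(smoothDE, smoothME)
  smooth_sumE.
rewrite (eq_bigr _ (fun j _ => Xt j)).
rewrite sgp smooth0E -[smooth_cst A (f p) p]/(f p) => H.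
apply: (mulfI (lt0r_neq0 (mulr_gt0 b0 b0))).
(* The terms in which [X] falls on [sg * sg] cancel, because [f] and the constant [f p] agree at
   [p]. *)
transitivity (\sum_(j < n) X (xi j) p * (bump x0 r x0 * 'D_(e_ j) F x0)).
  by apply: (addIr ((bump x0 r x0 * X sg p + X sg p * bump x0 r x0) * f p));
    rewrite H; ring.
rewrite mulr_sumr; apply: eq_bigr => j _; rewrite -/F.
by field; rewrite gt_eqF.
Qed.

End Charts.

(** * Local frames *)

Section LocalFrame.
Context (R : realType) (n : nat) (M : topologicalType) (A : atlas R n M).
Hypothesis hausdorffM : hausdorff_space M.
Implicit Types (f h : smooth_fun A) (X Y : vfield A).

Local Notation dom := (chart_dom A).
Local Notation fwd := (chart_fwd A).
Local Notation inv := (chart_inv A).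
Local Notation img i := (chart_fwd A i @` chart_dom A i).
Local Notation e_ j := (delta_mx (0 : 'I_1) j : 'rV[R]_n).

Section Frame.
Variables (i : chart_index A) (x0 : 'rV[R]_n) (r : R).
Hypotheses (r0 : 0 < r) (Ki : box x0 r `<=` img i).

Lemma smooth_cut F : smooth_on (img i) F -> smooth A (cut i x0 r F).
Proof. by apply: cut_smooth => //; exact: img_open. Qed.

Definition rho : smooth_fun A :=
  mk_smooth (smooth_cut (fun k => Ck_cst (@img_open _ _ _ A i) k 1)).

Definition rho_coord j : smooth_fun A :=
  mk_smooth (smooth_cut (fun k => Ck_coord k j (@img_open _ _ _ A i))).

Lemma smooth_partial f j : smooth_on (img i) ('D_(e_ j) (f \o inv i)).
Proof. by move=> k; have [_ /(_ j)[]] := smooth_chart f i k.+1. Qed.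

Definition frame_fun j f : smooth_fun A :=
  mk_smooth (smooth_cut (smooth_partial f j)).

Lemma frame_funE j f q : dom i q ->
  frame_fun j f q = rho q * 'D_(e_ j) (f \o inv i) (fwd i q).
Proof. by move=> qi; rewrite /= !cut_dom // mulr1. Qed.

Lemma rho_out q : ~ dom i q -> rho q = 0.
Proof. by move=> qi; rewrite /= /cut asboolF. Qed.

Lemma frame_fun_out j f q : ~ dom i q -> frame_fun j f q = 0.
Proof. by move=> qi; rewrite /= /cut asboolF. Qed.

Lemma chart_derivable f j q : dom i q ->
  derivable (f \o inv i) (fwd i q) (e_ j).
Proof.
move=> qi; have [_ /(_ j)[+ _]] := smooth_chart f i 1; apply.
exact: fwd_img.
Qed.

Lemma frame_derivation j : frame_fun j \in @derivation_pred _ _ _ A.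
Proof.
apply/asboolP; split=> [a f h|f h]; apply: smooth_ext => q;
  rewrite !(smoothDE, smoothME); have [qi|qi] := pselect (dom i q).
- rewrite !frame_funE //.
  have -> : (smooth_cst A a * f + h : smooth_fun A) \o inv i =
    (a \*: (f \o inv i) + (h \o inv i))%R by [].
  rewrite deriveD; [|apply: derivableZ;
    exact: chart_derivable | exact: chart_derivable].
  rewrite deriveZ; last exact: chart_derivable.
  by rewrite -[smooth_cst A a q]/a -[_ *: _]/(_ * _); ring.
- by rewrite !frame_fun_out // mulr0 addr0.
- rewrite !frame_funE //.
  have -> : (f * h : smooth_fun A) \o inv i =
    ((f \o inv i) * (h \o inv i))%R by [].
  rewrite deriveM; [|exact: chart_derivable..].
  by rewrite /= chart_fwdK // -![_ *: _]/(_ * _); ring.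
- by rewrite !frame_fun_out // mulr0 mul0r addr0.
Qed.

Definition frame j : vfield A := VField (frame_derivation j).

(** The coefficient rho X(rho x_j) - rho x_j X(rho), the numerator of a quotient rule, equals rho^2
    X(x_j) but involves only global functions. The third factor rho is the one in [frame j]. *)
Lemma frame_span X : exists a : 'I_n -> smooth_fun A,
  (rho * rho * rho) *: X = \sum_j a j *: frame j.
Proof.
exists (fun j => rho * X (rho_coord j) - rho_coord j * X rho).
apply: vfield_ext => f q; rewrite vfield_sumE smooth_sumE.
have [qi|qi] := pselect (dom i q); last first.
  rewrite -[LHS]/(rho q * rho q * rho q * X f q) rho_out // !mul0r big1 // => j
    _.
  by rewrite -[LHS]/(_ * frame_fun j f q) frame_fun_out // mulr0.
have [c Hc] := vfield_at hausdorffM X qi.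
rewrite -[LHS]/(rho q * rho q * rho q * X f q) Hc mulr_sumr.
apply: eq_bigr => j _.
rewrite -[RHS]/((rho q * X (rho_coord j) q - rho_coord j q * X rho q) *
  frame_fun j f q) frame_funE //.
suff -> : rho q * X (rho_coord j) q - rho_coord j q * X rho q =
  rho q * rho q * c j.
  by ring.
have nq : nbhs (fwd i q) (img i).
  by apply: open_nbhs_nbhs; split; [exact: img_open | exact: fwd_img].
have E1 : {near fwd i q, rho \o inv i =1 bump x0 r}.
  apply: filterS nq => y yi /=.
  by rewrite cut_dom ?mulr1 ?invK //; exact: inv_dom.
have E2 : {near fwd i q, rho_coord j \o inv i =1 (bump x0 r * (fun y : 'rV_n =>
  y 0 j))%R}.
  apply: filterS nq => y yi /=.
  by rewrite cut_dom ?invK //; exact: inv_dom.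
have db k : derivable (bump x0 r) (fwd i q) (e_ k).
  have [_ /(_ k)[+ _]] : Ck 1 setT (bump x0 r) by apply: Ck_bump; exact: openT.
  exact.
have -> : X (rho_coord j) q = \sum_(k < n) c k * (bump x0 r (fwd i q) * (j ==
  k)%:R +
    fwd i q 0 j * 'D_(e_ k) (bump x0 r) (fwd i q)).
  rewrite Hc; apply: eq_bigr => k _; rewrite (near_eq_derive _ E2).
  have [dc dcE] := derive_coord (fwd i q) k j.
  by rewrite deriveM // dcE.
have -> : X rho q = \sum_(k < n) c k * 'D_(e_ k) (bump x0 r) (fwd i q).
  by rewrite Hc; apply: eq_bigr => k _; rewrite (near_eq_derive _ E1).
have -> : rho_coord j q = rho q * fwd i q 0 j by rewrite /= !cut_dom // mulr1.
have -> : bump x0 r (fwd i q) = rho q by rewrite /= cut_dom // mulr1.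
rewrite !mulr_sumr -sumrB (bigD1 j) //= eqxx big1 => [|k kj]; last first.
  by rewrite eq_sym (negbTE kj) mulr0n; ring.
by rewrite addr0 mulr1n; ring.
Qed.

Definition chart_line (c : 'I_n ->
  R) (t : R) : 'rV[R]_n := x0 + t *: \row_j c j.

Lemma ball_img : ball x0 r `<=` img i.
Proof. by move=> x /ball_box/Ki. Qed.

Lemma rho_gt0 x : ball x0 r x -> 0 < rho (inv i x).
Proof.
move=> xB; have xi := ball_img xB.
rewrite /= cut_dom; last exact: inv_dom.
by rewrite invK // mulr1 bump_gt0.
Qed.

Lemma is_derive_frame f c t : ball x0 r (chart_line c t) ->
  is_derive t 1 (fun s => f (inv i (chart_line c s)))
    ((\sum_j smooth_cst A (c j) *: frame j) f (inv i (chart_line c t)) /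
     rho (inv i (chart_line c t))).
Proof.
move=> tB; have ti := ball_img tB.
have D j : is_derive t 1 (fun s => chart_line c s 0 j) (c j).
  have -> : (fun s => chart_line c s 0 j) = (cst (x0 0 j) + id * cst (c j))%R.
    by apply/funext => s; rewrite !mxE.
  by apply: is_derive_eq; rewrite scaler0 !add0r /cst [LHS]mulr1.
apply: (@is_derive_eq _ _ _ (fun s => f (inv i (chart_line c s))) t 1 _ _
  (is_derive_comp_row (@img_open _ _ _ A i) ti (smooth_chart f i 1) D)).
rewrite vfield_sumE smooth_sumE mulr_suml.
apply: eq_bigr => j _.
rewrite -[X in _ = X / _]/(c j * frame_fun j f _) frame_funE;
  last exact: inv_dom.
have p0 := rho_gt0 tB.
by rewrite invK //; field; rewrite gt_eqF.
Qed.

Lemma chart_line_cvg c t : chart_line c s @[s --> t] --> chart_line c t.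
Proof. by apply: cvgD; [exact: cvg_cst | apply: cvgZr_tmp; exact: cvg_id]. Qed.

End Frame.

(* [rho] is a bump function at p, the E_k are rho times the coordinate fields
   of a chart, and [gam c] is the line of direction c through p in that
   chart. *)
Lemma local_frame (p : M) :
  exists (rho : smooth_fun A) (E : 'I_n -> vfield A)
    (gam : ('I_n -> R) -> R -> M) (D : ('I_n -> R) -> set R),
  [/\ 0 < rho p,
      forall X, exists a : 'I_n -> smooth_fun A,
        (rho * rho * rho) *: X = \sum_j a j *: E j,
      forall c, gam c 0 = p /\ D c 0,
      forall c t, D c t -> [/\ \forall s \near t, D c s, 0 < rho (gam c t) &
        forall f, is_derive t 1 (fun s => f (gam c s))
          ((\sum_j smooth_cst A (c j) *: E j) f (gam c t) / rho (gam c t))] &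
      forall q, 0 < rho q -> exists c, gam c 1 = q /\
        forall t, 0 <= t <= 1 -> D c t].
Proof.
have [i pi] := chart_cover A p.
have [r r0 [r' Kr' [r'0 r'i]]] := box_chart pi.
set x0 := fwd i p in Kr' r'i *.
have Ki := subset_trans Kr' r'i.
exists (rho r0 Ki), (frame r0 Ki), (fun c t => inv i (chart_line x0 c t)),
  (fun c t => ball x0 r (chart_line x0 c t)); split.
- rewrite (_ : p = inv i x0); last by rewrite /x0 chart_fwdK.
  by apply: rho_gt0; exact: ballxx.
- exact: frame_span.
- move=> c; rewrite /chart_line scale0r addr0; split;
  first by rewrite /x0 chart_fwdK.
  exact: ballxx.
- move=> c t tB; split; [|exact: rho_gt0 | by move=> f; exact: is_derive_frame].
  apply: (@chart_line_cvg x0 c t); apply: open_nbhs_nbhs; split => //.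
  exact: ball_open.
- move=> q q0.
  have qi : dom i q by apply: contrapT => nqi; rewrite rho_out ?ltxx in q0.
  have qB : ball x0 r (fwd i q).
    by apply: (bump_gt0P r0); move: q0; rewrite /= cut_dom // mulr1.
  exists (fun j => fwd i q 0 j - x0 0 j); split.
    rewrite (_ : chart_line _ _ _ = fwd i q) ?chart_fwdK //.
    by apply/rowP => j; rewrite !mxE mul1r subrKC.
  move=> t /andP[t0 t1]; apply/ball_rowP => // j; rewrite !mxE.
  have /(ball_rowP _ _ r0)/(_ j) := qB; rewrite opprD addNKr normrN normrM.
  rewrite distrC ger0_norm // => H; apply: le_lt_trans H.
  by rewrite ler_piMl.
Qed.

End LocalFrame.

(** * Quadratic forms along a linear differential equation *)

Lemma cvg_sumr (T I : Type) (F : set_system T) (R : numFieldType) (s : seq I)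
    (f : I -> T -> R) (a : I -> R) : Filter F ->
  (forall i, f i x @[x --> F] --> a i) ->
  \sum_(i <- s) f i x @[x --> F] --> \sum_(i <- s) a i.
Proof.
move=> FF fa; elim: s => [|i s IH].
  by rewrite big_nil; under eq_fun do rewrite big_nil; exact: cvg_cst.
by rewrite big_cons; under eq_fun do rewrite big_cons; exact: cvgD.
Qed.

Lemma continuous_sumr (T : topologicalType) (I : Type) (R : numFieldType)
    (s : seq I) (f : I -> T -> R) (x : T) :
  (forall i, {for x, continuous (f i)}) ->
  {for x, continuous (fun y => \sum_(i <- s) f i y)}.
Proof. by move=> cf; apply: (@cvg_sumr _ _ (nbhs x)) => i; exact: cf. Qed.

Section RealLine.
Context (R : realType).

Lemma is_derive_left_lt (G : R -> R) (t d e : R) : is_derive t 1 G d -> d < 0 ->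
  0 < e -> exists2 s, t - e < s < t & G t < G s.
Proof.
move=> [dG dE] d0 e0.
have H : \forall h \near (0 : R)^', h^-1 *: ((G \o shift t) (h *: 1) - G t) < 0.
  have dl : h^-1 *: ((G \o shift t) (h *: 1) - G t) @[h --> 0^'] --> d.
    by rewrite -dE; exact: dG.
  exact: (cvgr_lt d dl).
have [k /= k0 Hk] := H.
pose h := - (Num.min k e / 2).
have m0 : 0 < Num.min k e by rewrite lt_min k0.
have m2 : Num.min k e / 2 < Num.min k e by rewrite ltr_pdivrMr // ltr_pMr //
  ltr1n.
have h0 : h < 0 by rewrite oppr_lt0 divr_gt0.
have hk : - h < k /\ - h < e.
  by rewrite opprK; split; apply: lt_le_trans m2 _; rewrite ge_min lexx ?orbT.
exists (t + h); first by rewrite ltrD2l ltrNl hk.2 /= gtrDl.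
have := Hk h; rewrite /= sub0r normrN ltr0_norm // => /(_ hk.1 (ltr0_neq0 h0)).
rewrite [h *: 1]mulr1 [h + t]addrC => H1.
rewrite -subr_gt0 ltNge; apply/negP => H2.
have H3 : 0 <= h^-1 * (G (t + h) - G t) by apply: mulr_le0 => //;
  rewrite invr_le0 ltW.
by have := le_lt_trans H3 H1; rewrite ltxx.
Qed.

Lemma is_derive_right_gt (G : R -> R) (t d e : R) : is_derive t 1 G d ->
  0 < d ->
  G t = 0 -> 0 < e -> exists2 k, 0 < k <= e & forall s, t < s < t + k ->
    0 < G s.
Proof.
move=> [dG dE] d0 Gt e0.
have H : \forall h \near (0 : R)^', 0 < h^-1 *: ((G \o shift t) (h *: 1) - G t).
  have dl : h^-1 *: ((G \o shift t) (h *: 1) - G t) @[h --> 0^'] --> d.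
    by rewrite -dE; exact: dG.
  exact: (cvgr_gt d dl).
have [k /= k0 Hk] := H.
exists (Num.min k e); first by rewrite lt_min k0 e0 ge_min lexx orbT.
move=> s /andP[ts sk].
have := Hk (s - t); rewrite /= sub0r normrN gtr0_norm ?subr_gt0 //.
have sk' : s - t < k.
  by rewrite ltrBlDl; apply: lt_le_trans sk _; rewrite lerD2l ge_min lexx.
move=> /(_ sk' (lt0r_neq0 _)); rewrite subr_gt0 => /(_ ts).
rewrite [(s - t) *: 1]mulr1 -[_ *: _]/(_ * _) subrK Gt subr0.
by rewrite pmulr_rgt0 // invr_gt0 subr_gt0.
Qed.

(** A second-derivative test for phi' = psi / r that never differentiates [r]: if psi'(0) > 0, then
    psi and so phi' are positive just right of 0, and the mean value theorem contradicts the
    maximum. In the application [r] is the bump [rho] along a coordinate line. *)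
Lemma max_derive (phi psi r : R -> R) (e d : R) : 0 < e ->
  (forall t : R, - e < t < e -> is_derive t (1 : R) phi (psi t / r t) /\ 0 < r
    t) ->
  (forall t, phi t <= phi 0) -> is_derive (0 : R) (1 : R) psi d ->
    psi 0 = 0 /\ d <= 0.
Proof.
move=> e0 Dphi maxphi Dpsi.
have z0 : - e < 0 < e by rewrite oppr_lt0 e0.
have [D0 r0] := Dphi 0 z0.
have psi0 : psi 0 = 0.
  have [] := @derive1_at_max R phi (- e) e 0.
  - by rewrite ltW // gtrN.
  - by move=> t; rewrite in_itv /= => /Dphi[[]].
  - by rewrite in_itv.
  - by move=> t _; exact: maxphi.
  move=> _ E; have [_ E'] := D0; move: E; rewrite E' => /eqP.
  by rewrite mulf_eq0 invr_eq0 (gt_eqF r0) orbF => /eqP.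
split => //; rewrite leNgt; apply/negP => d0.
have [k /andP[k0 ke] Hk] := is_derive_right_gt Dpsi d0 psi0 e0.
have k2 : k / 2 < k by rewrite ltr_pdivrMr // ltr_pMr // ltr1n.
have kk : 0 < k / 2 by rewrite divr_gt0.
have Dt (t : R) : 0 <= t <= k / 2 ->
  is_derive t (1 : R) phi (psi t / r t) /\ 0 < r t.
  move=> /andP[t0 tk]; apply: Dphi.
  by rewrite (lt_le_trans _ t0) ?oppr_lt0 //= (le_lt_trans tk) // (lt_le_trans
    k2).
have D1 (t : R) : t \in `]0, (k / 2)[%R ->
  is_derive t (1 : R) phi (psi t / r t).
  by rewrite in_itv /= => /andP[t0 tk]; have [] := Dt t; rewrite ?ltW.
have C1 : {within `[0, (k / 2)], continuous phi}.
  by apply: derivable_within_continuous => t; rewrite in_itv /= => /Dt[[]].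
have [c] := MVT kk D1 C1; rewrite in_itv /= => /andP[c0 ck] E.
have cI : 0 <= c <= k / 2 by rewrite !ltW.
have [_ rc] := Dt c cI.
have : 0 < phi (k / 2) - phi 0.
  rewrite E mulr_gt0 ?subr0 ?divr_gt0 ?Hk // c0 add0r /=.
  by apply: lt_trans ck k2.
by rewrite subr_gt0 ltNge maxphi.
Qed.

End RealLine.

Section QuadraticODE.
Context (R : realType) (n : nat).
Implicit Types (u w : 'rV[R]_n).

Definition bil (b : 'I_n -> 'I_n ->
  R) u w : R := \sum_i \sum_j u 0 i * w 0 j * b i j.
Definition sqn u : R := \sum_i u 0 i ^+ 2.

Lemma sqn_ge0 u : 0 <= sqn u.
Proof. by apply: sumr_ge0 => i _; exact: sqr_ge0. Qed.

Lemma sqn_eq0 u : sqn u = 0 -> u = 0.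
Proof.
move=> /eqP; rewrite psumr_eq0 => [|i _]; last exact: sqr_ge0.
move=> /allP H; apply/rowP => i; rewrite mxE.
by have := H i (mem_index_enum _); rewrite sqrf_eq0 => /eqP.
Qed.

Lemma sqnZ k u : sqn (k *: u) = k ^+ 2 * sqn u.
Proof. by rewrite mulr_sumr; apply: eq_bigr => i _; rewrite mxE exprMn. Qed.

Lemma bil0 b : bil b 0 0 = 0.
Proof.
by rewrite /bil big1 // => i _; rewrite big1 // => j _; rewrite mxE !mul0r.
Qed.

Lemma bilZ b k u : bil b (k *: u) (k *: u) = k ^+ 2 * bil b u u.
Proof.
rewrite mulr_sumr; apply: eq_bigr => i _; rewrite mulr_sumr;
  apply: eq_bigr => j _.
by rewrite !mxE; ring.
Qed.

Lemma bilD b u w x : (forall i j, b i j = b j i) ->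
  bil b (u + x *: w) (u + x *: w) =
    bil b u u + 2 * x * bil b u w + x ^+ 2 * bil b w w.
Proof.
move=> sb.
have sw : bil b w u = bil b u w.
  rewrite /bil exchange_big; apply: eq_bigr => i _; apply: eq_bigr => j _.
  by rewrite (sb j i) (mulrC (w 0 j)).
transitivity (bil b u u + x * bil b u w + x * bil b w u + x ^+ 2 * bil b w w).
  rewrite /bil !mulr_sumr -!big_split; apply: eq_bigr => i _ /=.
  rewrite !mulr_sumr -!big_split; apply: eq_bigr => j _ /=.
  by rewrite !mxE; ring.
by rewrite sw; ring.
Qed.

Lemma sqnE u : sqn u = bil (fun i j => (i == j)%:R) u u.
Proof.
apply: eq_bigr => i _; rewrite (bigD1 i) //= eqxx mulr1 big1 ?addr0 // => j ji.
by rewrite eq_sym (negbTE ji) mulr0.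
Qed.

(* A maximum point u of b on a Euclidean sphere is an eigenvector: the form
   mu |w|^2 - b(w, w) is nonnegative and vanishes at u, so u lies in its
   radical. *)
Lemma max_eigenvector b u mu : (forall i j, b i j = b j i) ->
  (forall w, bil b w w <= mu * sqn w) -> bil b u u = mu * sqn u ->
  forall i, \sum_j u 0 j * b i j = mu * u 0 i.
Proof.
move=> sb ub ueq i.
pose h i j := mu * (i == j)%:R - b i j.
have hE x y : bil h x y = mu * bil (fun i j => (i == j)%:R) x y - bil b x y.
  rewrite /bil mulr_sumr -sumrB; apply: eq_bigr => k _.
  rewrite mulr_sumr -sumrB; apply: eq_bigr => l _; rewrite /h; ring.
have sh k l : h k l = h l k by rewrite /h sb eq_sym.
have h0 w : 0 <= bil h w w by rewrite hE -sqnE subr_ge0.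
have hu : bil h u u = 0 by rewrite hE -sqnE ueq subrr.
pose w : 'rV[R]_n := delta_mx 0 i.
have hw : bil h u w = 0.
  set y := bil h w w; set x := bil h u w.
  have y0 : 0 <= y by exact: h0.
  have y1 : 0 < y + 1 by rewrite ltr_wpDl.
  (* The optimal multiple of [w] would be - x / y; the denominator [y + 1] allows y = 0 and still
     gives a negative value unless x = 0. *)
  have := h0 (u + (- (x / (y + 1))) *: w); rewrite bilD // hu add0r -/x -/y.
  rewrite (_ : _ + _ = - (x ^+ 2 * ((y + 2) / (y + 1) ^+ 2))); last first.
    by field; rewrite gt_eqF.
  rewrite oppr_ge0 pmulr_lle0 ?divr_gt0 ?exprn_gt0 ?ltr_wpDl //.
  move=> H; apply/eqP; rewrite -sqrf_eq0; apply/eqP/le_anti.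
  by rewrite H sqr_ge0.
have e c : bil c u w = \sum_k u 0 k * c k i.
  apply: eq_bigr => k _; rewrite (bigD1 i) //= big1 => [|l li].
    by rewrite mxE !eqxx mulr1 addr0.
  by rewrite mxE eqxx (negbTE li) mulr0 mul0r.
have E : \sum_k u 0 k * h k i = mu * u 0 i - \sum_k u 0 k * b i k.
  rewrite (eq_bigr (fun k => mu * (u 0 k * (k == i)%:R) - u 0 k * b i k)).
    rewrite sumrB -mulr_sumr; congr (_ * _ - _).
    rewrite (bigD1 i) //= eqxx mulr1 big1 ?addr0 // => k ki.
    by rewrite (negbTE ki) mulr0.
  by move=> k _; rewrite /h (sb i); ring.
by move/eqP: hw; rewrite e E subr_eq0 => /eqP.
Qed.

Lemma sphere_compact s : compact [set u : 'rV[R]_n | sqn u = s].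
Proof.
apply: (subclosed_compact _ (@box_compact R n 0 (`|s| + 1))).
  have cs : continuous sqn.
    move=> u; apply: continuous_sumr => i; apply: continuousM;
      exact: coord_continuous.
  exact: (@preimage_closed _ _ sqn [set x | x =
    s] (fun u _ => cs u) (@closed_eq R s)).
move=> u /= us j; rewrite mxE sub0r normrN.
have : u 0 j ^+ 2 <= `|s|.
  rewrite -us ger0_norm ?sqn_ge0 // /sqn (bigD1 j) //= lerDl.
  by apply: sumr_ge0 => i _; exact: sqr_ge0.
rewrite -real_normK ?num_real // => H; rewrite leNgt; apply/negP => H2.
have s0 : 0 <= `|s| by [].
have : (`|s| + 1) ^+ 2 < `|u 0 j| ^+ 2 by rewrite ltr_pXn2r // nnegrE //
  addr_ge0.
by move=> /lt_le_trans/(_ H); nra.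
Qed.

Lemma derivable_quadratic (b db : R -> 'I_n -> 'I_n -> R) u (t : R) :
  (forall i j, is_derive t (1 : R) (fun s => b s i j) (db t i j)) ->
  is_derive t (1 : R) (fun s => bil (b s) u u) (bil (db t) u u).
Proof.
move=> Db.
have D i : is_derive t (1 : R) (fun s => \sum_j u 0 i * u 0 j * b s i j)
    (\sum_j u 0 i * u 0 j * db t i j).
  rewrite (_ : (fun s => _) = \sum_(j < n) (fun s => u 0 i * u 0 j * b s i j)).
    by apply: is_derive_sum => j; exact: is_deriveZ.
  by apply/funext => s; rewrite fct_sumE.
rewrite (_ : (fun s => _) = \sum_(i < n) (fun s => \sum_j u 0 i * u 0 j * b s i
  j)).
  exact: is_derive_sum.
by apply/funext => s; rewrite fct_sumE.
Qed.

(* Maximize exp(- K t) b_t(u, u) over [0, 1] x sphere: at a positive maximum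
   (t, u), u is an eigenvector of b_t, so the time derivative there is
   exp(- K t) (2 mu <C u, u> - K mu |u|^2) < 0 once K is large, although the
   function does not increase to the left of t. *)
Lemma quadratic_ode_nonpos (b C : R -> 'I_n -> 'I_n -> R) (K0 : R) :
  (forall t i j, b t i j = b t j i) ->
  (forall (t : R) i k, 0 <= t <= 1 -> `|C t i k| <= K0) ->
  (forall (t : R) i j, 0 <= t <= 1 -> is_derive t (1 : R) (fun s => b s i j)
    (\sum_k (C t i k * b t k j + C t j k * b t k i))) ->
  (forall u, bil (b 0) u u <= 0) -> forall u, bil (b 1) u u <= 0.
Proof.
move=> sb CK Db b0 u1; rewrite leNgt; apply/negP => pos.
pose db t i j := \sum_k (C t i k * b t k j + C t j k * b t k i).
(* The sphere passes through [u1], so [(1, u1)] itself shows that the maximum is positive. *)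
pose s := sqn u1.
have s0 : 0 < s.
  rewrite lt_neqAle sqn_ge0 andbT eq_sym; apply/eqP => /sqn_eq0 u0.
  move: pos; by rewrite u0 bil0 ltxx.
(* For n = 0 no entry of [C] bounds [K0] from below, but then s = 0, which is excluded. *)
have K00 : 0 <= K0.
  case: (posnP n) => [n0|np].
    move: s0; rewrite /s /sqn big1 ?ltxx // => i _; move: (ltn_ord i).
    by rewrite {2}n0 ltn0.
  have t01 : 0 <= (0 : R) <= 1 by rewrite lexx ler01.
  exact: le_trans (normr_ge0 _) (CK 0 (Ordinal np) (Ordinal np) t01).
(* 2 K0 n bounds the growth rate at an eigenvector ([dq] below); the extra 1 makes the derivative
   strictly negative. *)
pose K := 2 * K0 * n%:R + 1.
pose F (z : R * 'rV[R]_n) := expR (- K * z.1) * bil (b z.1) z.2 z.2.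
pose D := (`[0%R, 1%R]%classic : set R) `*` [set u : 'rV[R]_n | sqn u = s].
have D1 : D (1, u1) by split => //=; rewrite in_itv /= ?lexx ?ler01.
have cD : compact D by apply: compact_setX;
  [exact: segment_compact | exact: sphere_compact].
have cF : {within D, continuous F}.
  apply: continuous_in_subspaceT => -[t u]; rewrite inE => -[/= t01 _].
  rewrite in_itv /= in t01.
  have cfst : {for (t, u), continuous (fun z : R * 'rV[R]_n => z.1)} by exact:
    cvg_fst.
  have csnd j : {for (t, u), continuous (fun z : R * 'rV[R]_n => z.2 0 j)}.
    apply: (cvg_comp snd (fun y : 'rV[R]_n => y 0 j)); first exact: cvg_snd.
    exact: coord_continuous.
  apply: (@continuousM _ _ (fun z : R * 'rV[R]_n => expR (- K * z.1))
    (fun z => bil (b z.1) z.2 z.2)).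
    apply: (cvg_comp (fun z : R * 'rV[R]_n => - K * z.1) expR).
      by apply: cvgM; [exact: cvg_cst | exact: cfst].
    exact: continuous_expR.
  apply: continuous_sumr => i; apply: continuous_sumr => j.
  apply: (@continuousM _ _ (fun z : R * 'rV[R]_n => z.2 0 i * z.2 0 j) (fun z
    => b z.1 i j)).
    by apply: (@continuousM _ _ (fun z : R * 'rV[R]_n => z.2 0 i) (fun z => z.2
      0 j)); exact: csnd.
  apply: (cvg_comp fst (fun t => b t i j)); first exact: cvg_fst.
  by apply: derivable_continuous; have [] := Db t i j t01.
have [[t u]] := compact_EVT_max (ex_intro _ _ D1) cD cF.
rewrite inE => -[/= t01 us] maxF; rewrite in_itv /= in t01.
have Ftu : 0 < F (t, u).
  apply: lt_le_trans (maxF (1, u1) _); last by rewrite inE.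
  by rewrite mulr_gt0 ?expR_gt0.
have qpos : 0 < bil (b t) u u by move: Ftu; rewrite pmulr_rgt0 ?expR_gt0.
have t0 : 0 < t.
  have /andP[+ _] := t01; rewrite le_eqVlt => /predU1P[tE|//].
  by move: qpos; rewrite -tE ltNge b0.
pose mu := bil (b t) u u / s.
have mu0 : 0 < mu by rewrite divr_gt0.
(* By homogeneity, maximality on the sphere at time [t] gives b_t(w, w) <= mu |w|^2 for every
   [w]. *)
have eig i : \sum_j u 0 j * b t i j = mu * u 0 i.
  apply: max_eigenvector => [//|w|]; last by rewrite us /mu divfK // gt_eqF.
  have [w0|w0] := eqVneq (sqn w) 0.
    by rewrite w0 mulr0 (sqn_eq0 w0) bil0.
  have wp : 0 < sqn w by rewrite lt_neqAle eq_sym w0 sqn_ge0.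
  pose k := Num.sqrt (s / sqn w).
  have k2 : k ^+ 2 = s / sqn w by rewrite sqr_sqrtr // divr_ge0 // ltW.
  have kw : sqn (k *: w) = s by rewrite sqnZ k2 divfK.
  have Dk : D (t, k *: w) by split => //=; rewrite in_itv.
  have := maxF (t, k *: w); rewrite inE => /(_ Dk).
  rewrite /F /= ler_pM2l ?expR_gt0 // bilZ k2 => H.
  rewrite /mu mulrAC ler_pdivlMr // mulrC.
  by move: H; rewrite mulrAC ler_pdivrMr.
have qmu : bil (b t) u u = mu * s by rewrite /mu divfK // gt_eqF.
clearbody mu.
have dq : bil (db t) u u <= 2 * K0 * n%:R * (mu * s).
  (* As [u] is an eigenvector of the symmetric [b t], the two terms of [db] contribute the same
     sum. *)
  have -> : bil (db t) u u = 2 * (\sum_i \sum_k u 0 i * C t i k * (mu * u 0 k)).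
    have T1 : \sum_i \sum_j u 0 i * u 0 j * (\sum_k C t i k * b t k j) =
        \sum_i \sum_k u 0 i * C t i k * (mu * u 0 k).
      apply: eq_bigr => i _.
      transitivity (\sum_j \sum_k u 0 i * C t i k * (u 0 j * b t k j)).
        apply: eq_bigr => j _; rewrite mulr_sumr; apply: eq_bigr => k _; ring.
      rewrite exchange_big; apply: eq_bigr => k _.
      by rewrite -mulr_sumr eig.
    have T2 : \sum_i \sum_j u 0 i * u 0 j * (\sum_k C t j k * b t k i) =
        \sum_i \sum_k u 0 i * C t i k * (mu * u 0 k).
      rewrite -T1 exchange_big; apply: eq_bigr => i _; apply: eq_bigr => j _.
      by rewrite (mulrC (u 0 j)).
    rewrite mulr2n mulrDl !mul1r -{1}T1 -T2 -big_split;
      apply: eq_bigr => i _ /=.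
    rewrite -big_split; apply: eq_bigr => j _ /=.
    by rewrite /db -mulrDr big_split.
  (* The bound is spread over all pairs i, k so that it can be compared termwise through |u_i| |u_k|
     <= (u_i^2 + u_k^2) / 2. *)
  have -> : 2 * K0 * n%:R * (mu * s) =
    2 * (\sum_i \sum_k (K0 * mu * ((u 0 i ^+ 2 + u 0 k ^+ 2) / 2))).
    have E1 : \sum_(i < n) \sum_(k < n) u 0 i ^+ 2 = n%:R * s.
      rewrite exchange_big (eq_bigr (fun=> s)) ?sumr_const ?card_ord ?mulr_natl
        //.
    have E2 : \sum_(i < n) \sum_(k < n) u 0 k ^+ 2 = n%:R * s.
      by rewrite -E1 exchange_big.
    transitivity (K0 * mu * (\sum_(i < n) \sum_(k < n) u 0 i ^+ 2 + \sum_(i <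
      n) \sum_(k < n) u 0 k ^+ 2)).
      by rewrite E1 E2; ring.
    rewrite -big_split !mulr_sumr; apply: eq_bigr => i _ /=.
    rewrite -big_split !mulr_sumr; apply: eq_bigr => k _ /=.
    by field.
  rewrite ler_pM2l //; apply: ler_sum => i _; apply: ler_sum => k _.
  apply: le_trans (ler_norm _) _; rewrite !normrM (ger0_norm (ltW mu0)).
  rewrite (_ : `|u 0 i| * `|C t i k| * (mu * `|u 0 k|) =
    mu * (`|C t i k| * (`|u 0 i| * `|u 0 k|))); last by ring.
  rewrite [K0 * mu]mulrC -mulrA ler_pM2l //.
  apply: ler_pM; [exact: normr_ge0 | by rewrite mulr_ge0 | exact: CK | ].
  rewrite -(real_normK (num_real (u 0 i))) -(real_normK (num_real (u 0 k))).
  have := sqr_ge0 (`|u 0 i| - `|u 0 k|); rewrite sqrrB; lra.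
have DF : is_derive t (1 : R) (fun x => F (x, u))
    (expR (- K * t) * (bil (db t) u u - K * bil (b t) u u)).
  have De : is_derive t (1 : R) (fun x : R => expR (- K * x)) (- K * expR (- K
    * t)).
    have Dl : is_derive t (1 : R) (fun x : R => - K * x) (- K).
      rewrite (_ : (fun x => _) = (- K) *: (id : R -> R))%R; last exact/funext.
      by apply: is_derive_eq; rewrite [LHS]mulr1.
    have := @is_derive1_comp R expR (fun x => - K * x) t _ _ (is_derive_expR _)
      Dl.
    by rewrite mulrC.
  have Dq := @derivable_quadratic b db u t (fun i j => Db t i j t01).
  apply: (@is_derive_eq _ _ _ (fun x => F (x, u)) t 1 _ _ (is_deriveM De Dq)).
  by rewrite -![_ *: _]/(_ * _) /=; ring.
have neg : expR (- K * t) * (bil (db t) u u - K * bil (b t) u u) < 0.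
  rewrite pmulr_rlt0 ?expR_gt0 // subr_lt0; apply: le_lt_trans dq _.
  by rewrite qmu ltr_pM2r ?mulr_gt0 // /K ltrDl.
have [x /andP[x1 x2] Fx] := is_derive_left_lt DF neg t0.
have /andP[_ t1] := t01.
have : D (x, u).
  split => //=; rewrite in_itv /=; move: x1; rewrite subrr => /ltW -> /=.
  exact: ltW (lt_le_trans x2 t1).
by move=> Dx; have := maxF (x, u); rewrite inE => /(_ Dx); rewrite leNgt Fx.
Qed.

End QuadraticODE.

(** * The maximum principle and parallel forms *)

Section Global.
Context (R : realType) (n : nat) (M : topologicalType) (A : atlas R n M).
Hypothesis hausdorffM : hausdorff_space M.
Implicit Types (f h w : smooth_fun A) (X Y Z : vfield A).

(** Along the coordinate lines through [p], [max_derive] settles the fields with constant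
    coefficients in the frame. A general [X] reduces to one of them, because all first derivatives
    of [w] vanish at [p]. *)
Lemma vfield_at_max w p X : (forall q, w q <= w p) ->
  X w p = 0 /\ X (X w) p <= 0.
Proof.
move=> wmax.
have [rho [E [gam [D [rhop span gam0 Dgam _]]]]] := local_frame A hausdorffM p.
pose V c := \sum_j smooth_cst A (c j) *: E j.
have key c d : (forall f, is_derive (0 : R) 1 (fun s => f (gam c s)) (V c f p /
  rho p)) ->
    d = V c (V c w) p -> V c w p = 0 /\ d <= 0.
  move=> D0 ->.
  have [g0 DD] := gam0 c.
  have [nD _ _] := Dgam c 0 DD.
  have /nbhs_ballP[e /= e0 De] := nD.
  have Dphi t : - e < t < e ->
      is_derive t (1 : R) (fun s => w (gam c s)) (V c w (gam c t) / rho (gam c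
        t)) /\
      0 < rho (gam c t).
    move=> te; have Dt : D c t by apply: De;
      rewrite /ball /= sub0r normrN ltr_norml.
    by have [_ rt DF] := Dgam c t Dt; split.
  have H := @max_derive R (fun t => w (gam c t)) (fun t => V c w (gam c t))
    (fun t => rho (gam c t)) e _ e0 Dphi _ (D0 (V c w)).
  have [|H1 H2] := H; first by move=> t; rewrite g0; exact: wmax.
  rewrite g0 in H1; split => //.
  by move: H2; rewrite ler_pdivrMr // mul0r.
have D0 c f : is_derive (0 : R) 1 (fun s => f (gam c s)) (V c f p / rho p).
  have [g0 DD] := gam0 c; have [_ _ /(_ f)] := Dgam c 0 DD.
  by rewrite g0.
have Vw c : V c w p = 0 by have [] := key c _ (D0 c) erefl.
have VVw c : V c (V c w) p <= 0 by have [] := key c _ (D0 c) erefl.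
have [a Ha] := span X.
pose c j := a j p.
pose r3 := rho p * rho p * rho p.
have r30 : 0 < r3 by rewrite !mulr_gt0.
have XV f : r3 * X f p = V c f p.
  rewrite -[LHS]/(((rho * rho * rho) *: X) f p) Ha /V !vfield_sumE !smooth_sumE.
  by apply: eq_bigr.
have Xw : X w p = 0.
  by apply: (mulfI (lt0r_neq0 r30)); rewrite XV Vw mulr0.
have Ew j : E j w p = 0.
  have := Vw (fun k => (k == j)%:R); rewrite /V vfield_sumE smooth_sumE.
  rewrite (bigD1 j) //= big1 ?addr0 => [|k kj].
    by rewrite -[LHS]/((j == j)%:R * E j w p) eqxx mul1r.
  by rewrite -[LHS]/((k == j)%:R * E k w p) (negbTE kj) mul0r.
split=> //.
have e1 : X ((rho * rho * rho) * X w) p = r3 * X (X w) p.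
  rewrite vfieldM smoothDE !smoothME Xw mulr0 addr0 //.
(* The coefficients [a j] may be frozen at [p]: their derivatives are multiplied by [E j w p], which
   is 0. *)
have e2 : X ((rho * rho * rho) * X w) p = X (V c w) p.
  rewrite -[(rho * rho * rho) * X w]/(((rho * rho * rho) *: X) w) Ha /V.
  rewrite !vfield_sumE !vfield_sum !smooth_sumE; apply: eq_bigr => j _.
  rewrite -[(a j *: E j) w]/(a j * E j w) -[(smooth_cst A (c j) *: E j)
    w]/(smooth_cst A (c j) * E j w).
  by rewrite !vfieldM !smoothDE !smoothME Ew !mulr0 !addr0.
have : r3 * (r3 * X (X w) p) <= 0 by rewrite -e1 e2 XV.
by rewrite !pmulr_rle0.
Qed.

(** * Propagation of the sign of a parallel symmetric form *)

Section Transport.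
Variables (beta : vfield A -> vfield A -> smooth_fun A)
  (Dv : vfield A -> vfield A -> vfield A).
Hypotheses (betaD : forall f X Y Z, beta (f *: X + Y) Z =
  f * beta X Z + beta Y Z)
  (betaC : forall X Y, beta X Y = beta Y X)
  (beta_parallel : forall Z X Y, Z (beta X Y) =
    beta (Dv Z X) Y + beta X (Dv Z Y)).

Lemma form0 Z : beta 0 Z = 0.
Proof. by have := betaD (-1) 0 0 Z; rewrite scaler0 addr0 mulN1r addNr. Qed.

Lemma formZ f X Z : beta (f *: X) Z = f * beta X Z.
Proof. by rewrite -[f *: X]addr0 betaD form0 addr0. Qed.

Lemma formD X Y Z : beta (X + Y) Z = beta X Z + beta Y Z.
Proof. by rewrite -[X]scale1r betaD mul1r scale1r. Qed.

Lemma form_sum (I : Type) (s : seq I) (X : I -> vfield A) Z :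
  beta (\sum_(i <- s) X i) Z = \sum_(i <- s) beta (X i) Z.
Proof.
elim: s => [|i s IH]; first by rewrite !big_nil form0.
by rewrite !big_cons formD IH.
Qed.

Lemma form_quadratic (a : 'I_n -> smooth_fun A) (E : 'I_n -> vfield A) q :
  beta (\sum_i a i *: E i) (\sum_j a j *: E j) q =
  bil (fun i j => beta (E i) (E j) q) (\row_i a i q) (\row_i a i q).
Proof.
rewrite form_sum smooth_sumE; apply: eq_bigr => i _.
rewrite formZ betaC form_sum smoothME smooth_sumE mulr_sumr;
  apply: eq_bigr => j _.
by rewrite formZ betaC smoothME !mxE mulrA.
Qed.

(** A coordinate line joins [p] to each point where rho > 0, and along it parallelism turns the
    matrix of [beta] in the frame into a solution of the equation of [quadratic_ode_nonpos]. The
    sign obtained on the frame extends to any [X], as rho^3 X is a combination of the frame. *)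
Lemma nonpos_near p : (forall X, beta X X p <= 0) ->
  \forall q \near p, forall X, beta X X q <= 0.
Proof.
move=> bp.
have [rho [E [gam [D [rhop span gam0 Dgam rhoD]]]]] :=
  local_frame A hausdorffM p.
have nrho : nbhs p [set q | 0 < rho q].
  have o : nbhs (rho p) [set x | 0 < x].
    by apply: open_nbhs_nbhs; split => //; exact: open_gt.
  exact: (@smooth_continuous _ _ _ _ rho p _ o).
apply: filterS nrho => q q0 X.
have [c [g1 Dc]] := rhoD q q0.
pose V := \sum_j smooth_cst A (c j) *: E j.
have /choice[a Ha] : forall j, exists a : 'I_n -> smooth_fun A,
    (rho * rho * rho) *: Dv V (E j) = \sum_k a k *: E k by move=> j;
      exact: span.
pose b t i j := beta (E i) (E j) (gam c t).
(* Three factors rho come from writing D_V E_i in the frame, the fourth from the velocity V / rho of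
   the line. *)
pose C t i k := a i k (gam c t) / rho (gam c t) ^+ 4.
have rpos t : 0 <= t <= 1 -> 0 < rho (gam c t).
  by move=> /Dc Dt; have [] := Dgam c t Dt.
have Df (t : R) f : 0 <= t <= 1 ->
    is_derive t (1 : R) (fun s => f (gam c s)) (V f (gam c t) / rho (gam c t)).
  by move=> /Dc Dt; have [_ _ +] := Dgam c t Dt; apply.
have Cc i k : exists K, forall t, 0 <= t <= 1 -> `|C t i k| <= K.
  have : compact ((fun t => C t i k) @` `[0%R, 1%R]).
    apply: continuous_compact; last exact: segment_compact.
    apply: continuous_within => t t01.
    have cf f : {for t, continuous (fun s => f (gam c s))}.
      by apply: derivable_continuous; have [] := Df t f t01.
    apply: (@continuousM _ _ (fun s => a i k (gam c s)) (fun s => (rho (gam c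
      s) ^+ 4)^-1)).
      exact: cf.
    apply: (@continuousV _ _ (fun s => rho (gam c s) ^+ 4)).
      by rewrite expf_neq0 // gt_eqF // rpos.
    exact: (cf (rho ^+ 4)).
  move=> /compact_bounded[K [_ HK]]; exists (K + 1) => t t01.
  by apply: (HK (K + 1)); [rewrite ltrDl | exists t => //=; rewrite in_itv].
have /choice[K HK] : forall i, exists K, forall k t, 0 <= t <= 1 ->
  `|C t i k| <= K k.
  move=> i; have /choice[K HK] := Cc i; exists K => k t; exact: HK.
pose K0 := \sum_i \sum_k `|K i k|.
have CK (t : R) i k : 0 <= t <= 1 -> `|C t i k| <= K0.
  move=> t01; apply: le_trans (HK i k t t01) _; apply: le_trans (ler_norm _) _.
  rewrite /K0 (bigD1 i) //= (bigD1 k) //= -addrA lerDl.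
  by apply: addr_ge0; apply: sumr_ge0 => // j _; apply: sumr_ge0.
have Db (t : R) i j : 0 <= t <= 1 -> is_derive t (1 : R) (fun s => b s i j)
    (\sum_k (C t i k * b t k j + C t j k * b t k i)).
  move=> t01; apply: (is_derive_eq (Df t (beta (E i) (E j)) t01)).
  have r0 := rpos t t01.
  have part l m : beta (Dv V (E l)) (E m) (gam c t) =
      rho (gam c t) * \sum_k C t l k * b t k m.
    have : (rho * rho * rho * beta (Dv V (E l)) (E m)) (gam c t) =
        \sum_k a l k (gam c t) * b t k m.
      rewrite -formZ Ha form_sum smooth_sumE; apply: eq_bigr => k _.
      by rewrite formZ smoothME.
    rewrite !smoothME => H.
    apply: (mulfI (lt0r_neq0 (mulr_gt0 (mulr_gt0 r0 r0) r0))); rewrite H.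
    rewrite mulrA mulr_sumr; apply: eq_bigr => k _; rewrite /C.
    by field; rewrite gt_eqF.
  rewrite beta_parallel smoothDE (betaC (E i)) !part -mulrDr mulrAC mulfV
    ?gt_eqF //.
  by rewrite mul1r big_split.
have b0 u : bil (b 0) u u <= 0.
  have [g0 _] := gam0 c.
  have := bp (\sum_i smooth_cst A (u 0 i) *: E i); rewrite form_quadratic /b g0.
  by congr (bil _ _ _ <= 0); apply/rowP => i; rewrite mxE.
have b1 := @quadratic_ode_nonpos R n b C K0 (fun t i j => congr1 (fun f :
  smooth_fun A => f (gam c t)) (betaC (E i) (E j))) CK Db b0.
have [x Hx] := span X.
have : beta ((rho * rho * rho) *: X) ((rho * rho * rho) *: X) q <= 0.
  by rewrite Hx form_quadratic -g1; exact: b1.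
rewrite formZ betaC formZ !smoothME.
by rewrite !pmulr_rle0 // !mulr_gt0.
Qed.

(** The points where the form is nonpositive form a set that is open by [nonpos_near] and closed by
    continuity. *)
Lemma nonpos_everywhere p : connected [set: M] -> (forall X, beta X X p <= 0) ->
  forall q X, beta X X q <= 0.
Proof.
move=> cM bp q.
pose S := [set q | forall X, beta X X q <= 0].
suff SE : S = setT by have : S q by rewrite SE.
apply: cM; first by exists p.
- exists S; last by rewrite setTI.
  by rewrite openE => x Sx; exact: nonpos_near.
- exists S; last by rewrite setTI.
  have -> : S = \bigcap_(X in setT) [set q | beta X X q <= 0].
    by apply/seteqP; split=> x H X; [move=> _; exact: H | exact: (H X I)].
  apply: closed_bigI => X _.
  exact: (@preimage_closed _ _ (beta X X) [set x | x <= 0] (fun u _ =>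
    @smooth_continuous _ _ _ _ (beta X X) u) (@closed_le R 0)).
Qed.

End Transport.

End Global.

(** * Cochains of degree at most two *)

Section LowDegree.
Context (R : realType) (n : nat) (M : topologicalType) (A : atlas R n M).
Local Notation S := (smooth_fun A).
Local Notation V := (vfield A).
Local Notation cf := (cfun A).

Local Notation half := (smooth_cst A 2^-1).

Lemma half_half : half + half = 1.
Proof.
apply: smooth_ext => q; rewrite smoothDE -[LHS]/(2^-1 + 2^-1 : R).
by rewrite -mulr2n -[LHS]mulr_natl mulfV // pnatr_eq0.
Qed.

(** [ring] treats [half] as an unknown; this brings identities that need half + half = 1 into its
    reach. *)
Lemma half_eq (x y : S) : y = (half + half) * x -> x = y.
Proof. by rewrite half_half mul1r. Qed.

Lemma sum_set1 (W : nmodType) (F : {set 'I_1} -> W) :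
  \sum_T F T = F finset.set0 + F [set: _]%SET.
Proof.
rewrite (bigD1 finset.set0) //= (bigD1 [set: _]%SET) /=; last first.
  by apply/eqP => /finset.setP/(_ ord0); rewrite !inE.
rewrite big1 ?addr0 // => T /andP[T0 T1]; exfalso.
have [h|h] := boolP (ord0 \in T).
  by case/eqP: T1; apply/finset.setP => i; rewrite (ord1 i) h inE.
by case/eqP: T0; apply/finset.setP => i; rewrite (ord1 i) (negbTE h) inE.
Qed.

Lemma ord2P (i : 'I_2) : i = ord0 \/ i = ord_max.
Proof. by case: i => [[|[|m]] Hm] //; [left | right]; exact: val_inj. Qed.

Lemma sum_set2 (W : nmodType) (F : {set 'I_2} -> W) :
  \sum_T F T = F finset.set0 + F [set ord0]%SET + F [set ord_max]%SET + F [set: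
    _]%SET.
Proof.
rewrite (bigD1 finset.set0) //= (bigD1 [set ord0]%SET) /=; last first.
  by apply/eqP => /finset.setP/(_ ord0); rewrite !inE.
rewrite (bigD1 [set ord_max]%SET) /=; last first.
  apply/andP; split; apply/eqP => /finset.setP/(_ ord_max); rewrite !inE //.
rewrite (bigD1 [set: _]%SET) /=; last first.
  apply/andP; split; first apply/andP; first split.
  - by apply/eqP => /finset.setP/(_ ord0); rewrite !inE.
  - by apply/eqP => /finset.setP/(_ ord_max); rewrite !inE.
  - by apply/eqP => /finset.setP/(_ ord0); rewrite !inE.
rewrite big1 ?addr0 ?addrA // => T /andP[/andP[/andP[T0 T1] T2] T3]; exfalso.
have ext (U : {set 'I_2}) : (ord0 \in T) = (ord0 \in U) ->
    (ord_max \in T) = (ord_max \in U) -> T = U.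
  by move=> e1 e2; apply/finset.setP => i; have [->|->] := ord2P i.
have [h|h] := boolP (ord0 \in T); have [h'|h'] := boolP (ord_max \in T).
- by case/eqP: T3; apply: ext; rewrite ?h ?h' !inE.
- by case/eqP: T1; apply: ext; rewrite ?h ?(negbTE h') !inE.
- by case/eqP: T2; apply: ext; rewrite ?h' ?(negbTE h) !inE.
- by case/eqP: T0; apply: ext; rewrite ?(negbTE h') ?(negbTE h) !inE.
Qed.

Definition cochain0 (u w : S) : cochain A 0 := fun _ => (u, w).
Definition cochain1 (a b : V -> S) : cochain A 1 :=
  fun X => (a (X ord0), b (X ord0)).
Definition cochain2 (a b : V -> V -> S) : cochain A 2 :=
  fun X => (a (X ord0) (X ord_max), b (X ord0) (X ord_max)).

Lemma cochain0_surj (b : cochain A 0) : exists u w, b = cochain0 u w.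
Proof.
exists (b (fun=> 0)).1, (b (fun=> 0)).2; apply/funext => X.
by rewrite /cochain0 -surjective_pairing; congr b; apply/funext => -[].
Qed.

Definition ext_d1 (a : V -> S) (X Y : V) : S :=
  X (a Y) - Y (a X) - a (lie_bracket X Y).
(** For alternating [a] the last term is - a([Y, Z], X): as in [ext_d], a bracket stands in the slot
    of its first field. *)
Definition ext_d2 (a : V -> V -> S) (X Y Z : V) : S :=
  X (a Y Z) - (Y (a X Z) + a (lie_bracket X Y) Z) +
  (Z (a X Y) + (a (lie_bracket X Z) Y + a X (lie_bracket Y Z))).

Lemma ext_d_cochain0 u w : ext_d (cochain0 u w) =
  cochain1 (fun X => X u) (fun X => X w).
Proof.
apply/funext => X; rewrite /ext_d big_ord_recl big_ord0 addr0.
rewrite [\sum_(i < 1 | _) _]big1 => [|[[|m] Hm]] //.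
by rewrite addr0 expr0 /cfun_scale !mul1r.
Qed.

Lemma big_lt1 (W : nmodType) k (F : 'I_k.+1 -> W) :
  \sum_(i < k.+1 | (i < (ord0 : 'I_k.+1))%N) F i = 0.
Proof. by rewrite big1. Qed.

Lemma lift10 : lift ord0 ord0 = ord_max :> 'I_2. Proof. exact: val_inj. Qed.
Lemma lift11 : lift ord_max ord0 = ord0 :> 'I_2. Proof. exact: val_inj. Qed.

Lemma ext_d_cochain1 a b : ext_d (cochain1 a b) =
  cochain2 (ext_d1 a) (ext_d1 b).
Proof.
apply/funext => X; rewrite /ext_d !big_ord_recl big_ord0 addr0 lift10.
rewrite big_lt1.
have -> : \sum_(i < 2 | (i < (ord_max : 'I_2))%N) cochain1 a b (fun m => 
    if lift ord_max m == i then lie_bracket (X i) (X ord_max) else X (lift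
      ord_max m)) =
    cochain1 a b (fun=> lie_bracket (X ord0) (X ord_max)).
  rewrite (bigD1 ord0) //= big1 ?addr0; last by move=> i;
    case: i => [[|[|m]] Hm].
  by rewrite /cochain1 lift11 eqxx.
rewrite /= expr0 expr1 addr0 /cochain1 lift10 lift11.
by congr (_, _); rewrite /= /ext_d1; ring.
Qed.

Lemma ext_d_cochain2 a b : ext_d (cochain2 a b) =
  fun X => let Y := X ord0 in let Z := X (lift ord0 ord0) in let W :=
    X ord_max in
    (ext_d2 a Y Z W, ext_d2 b Y Z W).
Proof.
apply/funext => X; rewrite /ext_d !big_ord_recl big_ord0 addr0.
have e2 : lift ord0 (lift ord0 ord0) = ord_max :> 'I_3 by exact: val_inj.
rewrite e2 big_lt1; set o1 := lift ord0 ord0.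
have l00 : lift (ord0 : 'I_3) (ord0 : 'I_2) = o1 by [].
have l01 : lift (ord0 : 'I_3) (ord_max : 'I_2) = ord_max by exact: val_inj.
have l10 : lift o1 (ord0 : 'I_2) = ord0 by exact: val_inj.
have l11 : lift o1 (ord_max : 'I_2) = ord_max by exact: val_inj.
have l20 : lift (ord_max : 'I_3) (ord0 : 'I_2) = ord0 by exact: val_inj.
have l21 : lift (ord_max : 'I_3) (ord_max : 'I_2) = o1 by exact: val_inj.
have -> : \sum_(i < 3 | (i < o1)%N) cochain2 a b (fun m => 
    if lift o1 m == i then lie_bracket (X i) (X o1) else X (lift o1 m)) =
    (a (lie_bracket (X ord0) (X o1)) (X ord_max), b (lie_bracket (X ord0) (X
      o1)) (X ord_max)).
  rewrite (bigD1 ord0) //= big1 ?addr0; last by move=> i;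
    case: i => [[|[|[|m]]] Hm].
  by rewrite /cochain2 l10 l11 eqxx.
have -> : \sum_(i < 3 | (i < (ord_max : 'I_3))%N) cochain2 a b (fun m => 
    if lift ord_max m == i then lie_bracket (X i) (X ord_max) else X (lift
      ord_max m)) =
    (a (lie_bracket (X ord0) (X ord_max)) (X o1), b (lie_bracket (X ord0) (X
      ord_max)) (X o1)) +
    (a (X ord0) (lie_bracket (X o1) (X ord_max)), b (X ord0) (lie_bracket (X
      o1) (X ord_max))).
  rewrite (bigD1 ord0) //= (bigD1 o1) //= big1 ?addr0; last first.
    by move=> i; case: i => [[|[|[|m]]] Hm].
  by rewrite /cochain2 l20 l21 !eqxx.
rewrite /cochain2 l00 l01 l10 l11 l20 l21.
by congr (_, _); rewrite /= /ext_d2 /bump /= ?addn0 ?addn1 expr0 expr1 ?expr2;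
  ring.
Qed.

Lemma complexify1 (a : cochain A 1) Z :
  complexify a Z = a (fun j => (Z j).1) + mul_i (a (fun j => (Z j).2)).
Proof.
rewrite /complexify sum_set1 cards0 cardsT card_ord /=;
  congr (a _ + mul_i (a _)).
  by apply/funext => j; rewrite inE.
by apply/funext => j; rewrite inE.
Qed.

Lemma complexify_cochain2 (a b : V -> V -> S) (Z : 'I_2 -> V * V) :
  complexify (cochain2 a b) Z =
  let X := (Z ord0).1 in let X' := (Z ord0).2 in
  let Y := (Z ord_max).1 in let Y' := (Z ord_max).2 in
  (a X Y - b X' Y - b X Y' - a X' Y', b X Y + a X' Y + a X Y' - b X' Y').
Proof.
rewrite /complexify sum_set2 cards0 !cards1 cardsT card_ord /= /cochain2 !inE
  /=.
by congr (_, _); rewrite /=; ring.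
Qed.

(** * Tensoriality and type projections in degrees at most two *)

Section Types.
Variable J : {linear V -> V}.

Definition tensor1 (a : V -> S) := forall f X Y, a (f *: X + Y) = f * a X + a Y.

Definition tensor2 (a : V -> V -> S) :=
  (forall f X Y Z, a (f *: X + Y) Z = f * a X Z + a Y Z) /\
  (forall f X Y Z, a Z (f *: X + Y) = f * a Z X + a Z Y).

Lemma tensor1_0 a : tensor1 a -> a 0 = 0.
Proof. by move=> ta; have := ta (-1) 0 0;
  rewrite scaler0 addr0 mulN1r addNr. Qed.

Lemma tensor1Z a f X : tensor1 a -> a (f *: X) = f * a X.
Proof. by move=> ta; rewrite -[f *: X]addr0 ta tensor1_0 // addr0. Qed.

Lemma tensor1N a X : tensor1 a -> a (- X) = - a X.
Proof. by move=> ta; rewrite -scaleN1r tensor1Z // mulN1r. Qed.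

Lemma tensor1D a X Y : tensor1 a -> a (X + Y) = a X + a Y.
Proof. by move=> ta; rewrite -[X]scale1r ta mul1r scale1r. Qed.

Lemma tensor2_1 a Z : tensor2 a -> tensor1 (a^~ Z).
Proof. by move=> [ta _] f X Y; exact: ta. Qed.

Lemma tensor2_2 a Z : tensor2 a -> tensor1 (a Z).
Proof. by move=> [_ ta] f X Y; exact: ta. Qed.

Lemma tensor2Zl a f X Z : tensor2 a -> a (f *: X) Z = f * a X Z.
Proof. by move=> /(@tensor2_1 _ Z)/tensor1Z; apply. Qed.

Lemma tensor2Zr a f X Z : tensor2 a -> a Z (f *: X) = f * a Z X.
Proof. by move=> /(@tensor2_2 _ Z)/tensor1Z; apply. Qed.

Lemma tensor2Nl a X Z : tensor2 a -> a (- X) Z = - a X Z.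
Proof. by move=> /(@tensor2_1 _ Z)/tensor1N; apply. Qed.

Lemma tensor2Nr a X Z : tensor2 a -> a Z (- X) = - a Z X.
Proof. by move=> /(@tensor2_2 _ Z)/tensor1N; apply. Qed.

Lemma cochain1_form a b : tensor1 a -> tensor1 b -> is_form (cochain1 a b).
Proof.
move=> ta tb; split=> [i f X Y Z|i j X]; last by rewrite (ord1 i) (ord1 j) eqxx.
by rewrite (ord1 i) => Zi _; rewrite /cochain1 Zi ta tb.
Qed.

Lemma cochain2_form a b : tensor2 a -> tensor2 b -> (forall X, a X X = 0) ->
  (forall X, b X X = 0) -> is_form (cochain2 a b).
Proof.
move=> [ta ta'] [tb tb'] aa bb; split=> [i f X Y Z|i j X].
  have [->|->] := ord2P i => Zi H.
    have [HX HY] := H ord_max isT.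
    by rewrite /cochain2 Zi HX HY ta tb.
  have [HX HY] := H ord0 isT.
  by rewrite /cochain2 Zi HX HY ta' tb'.
have [->|->] := ord2P i; have [->|->] := ord2P j; rewrite ?eqxx // => _ e;
  by rewrite /cochain2 e aa bb.
Qed.

Lemma type_part_cochain0 u w : type_part J 0 (cochain0 u w) = cochain0 u w.
Proof.
apply/funext => X; rewrite /type_part (bigD1 finset.set0) ?cards0 //= big1
  ?addr0; last first.
  by move=> T /andP[/eqP/cards0_eq -> /eqP].
rewrite /complexify (bigD1 finset.set0) //= cards0 big1 ?addr0 // => T /eqP T0.
by exfalso; apply: T0; apply/finset.setP => -[].
Qed.

Lemma type_part_cochain1 a b : tensor1 a -> tensor1 b ->
  type_part J 0 (cochain1 a b) = cochain1 (fun X => half * (a X - b (J X)))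
    (fun X => half * (b X + a (J X))) /\
  type_part J 1 (cochain1 a b) = cochain1 (fun X => half * (a X + b (J X)))
    (fun X => half * (b X - a (J X))).
Proof.
move=> ta tb; split; apply/funext => X;
  rewrite /type_part big_mkcond sum_set1 cards0 cardsT card_ord /=
  complexify1 ?add0r ?addr0 /cochain1 !inE /=; congr (_, _);
    rewrite /= !(tensor1N _ ta, tensor1N _ tb, tensor1Z _ _ ta, tensor1Z _ _
    tb).
all: ring.
Qed.

Lemma type_part_cochain2 a b : tensor2 a -> tensor2 b ->
  [/\ type_part J 2 (cochain2 a b) = cochain2
     (fun X Y => half * half * (a X Y - a (J X) (J Y) + b (J X) Y + b X (J Y)))
     (fun X Y => half * half * (b X Y - b (J X) (J Y) - a (J X) Y - a X (J Y))),
    type_part J 1 (cochain2 a b) = cochain2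
     (fun X Y => half * (a X Y + a (J X) (J Y)))
     (fun X Y => half * (b X Y + b (J X) (J Y))) &
    type_part J 0 (cochain2 a b) = cochain2
     (fun X Y => half * half * (a X Y - a (J X) (J Y) - b (J X) Y - b X (J Y)))
     (fun X Y => half * half * (b X Y - b (J X) (J Y) + a (J X) Y + a X (J
       Y)))].
Proof.
move=> ta tb; split; apply/funext => X;
  rewrite /type_part big_mkcond sum_set2 cards0 !cards1 cardsT card_ord /=
  !complexify_cochain2 ?add0r ?addr0 /cochain2 !inE /=; congr (_, _);
  rewrite /= !(tensor2Nl _ _ ta, tensor2Nl _ _ tb, tensor2Nr _ _ ta, tensor2Nr
    _ _ tb,
   tensor2Zl _ _ _ ta, tensor2Zl _ _ _ tb, tensor2Zr _ _ _ ta, tensor2Zr _ _ _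
     tb).
- ring.
- ring.
(* Two subsets contribute to type (1, 1), and their quarters add up to [half]. *)
- apply/esym/half_eq; ring.
- apply/esym/half_eq; ring.
- ring.
- ring.
Qed.

End Types.

End LowDegree.

(** * Affine vector fields *)

Section Affine.
Context (R : realType) (n : nat) (M : topologicalType) (A : atlas R n M).
Local Notation S := (smooth_fun A).
Local Notation V := (vfield A).
Local Notation half := (smooth_cst A 2^-1).
Local Notation "[ X , Y ]" := (lie_bracket X Y).

Variables (g : V -> V -> S) (D : V -> V -> V) (J : {linear V -> V}) (v : V).
Hypothesis kahlerM : is_pseudo_kahler g D J.
Hypothesis affine_v : is_affine D v.

Implicit Types (X Y Z : V) (f u w : S).

Local Notation omega := (kahler_form g J).

Let metric_g : is_metric g. Proof. by case: kahlerM. Qed.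
Let lc : is_levi_civita g D. Proof. by case: kahlerM. Qed.

Lemma JJ X : J (J X) = - X.
Proof. by case: kahlerM => _ _ acJ _ _; exact: acJ. Qed.

Lemma DJ X Y : D X (J Y) = J (D X Y).
Proof. by case: kahlerM. Qed.

Lemma torsion_free X Y : D X Y - D Y X = [X, Y].
Proof. by case: lc. Qed.

Lemma DD X Y Z : D X (Y + Z) = D X Y + D X Z.
Proof. by case: lc. Qed.

Lemma bracketE X Y f : [X, Y] f = X (Y f) - Y (X f).
Proof. by []. Qed.

Lemma omega_tensor : tensor2 omega.
Proof.
case: metric_g => gl gC _; split=> f X Y Z; rewrite /kahler_form.
  by rewrite linearP gl.
by rewrite gC gl !(gC (J Z)).
Qed.

Lemma omega_alt X Y : omega X Y = - omega Y X.
Proof.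
case: metric_g => gl gC _; case: kahlerM => _ _ _ gJ _.
rewrite /kahler_form -gJ JJ.
have tg : tensor1 (g^~ (J Y)) by move=> f X' Y'; exact: gl.
by rewrite (tensor1N _ tg) gC.
Qed.

Lemma omega_parallel Z X Y : Z (omega X Y) = omega (D Z X) Y + omega X (D Z Y).
Proof. by case: lc => _ _ _ _ gD; rewrite /kahler_form gD DJ. Qed.

(** Since omega is parallel, this is the covariant derivative (D_X eta)(Y) of eta = omega(v, .). *)
Definition omega_nabla X Y := omega (D X v) Y.

Lemma omega_nabla_tensor : tensor2 omega_nabla.
Proof.
case: lc => Dl _ _ _ _; have [ol orr] := omega_tensor.
by split=> f X Y Z; rewrite /omega_nabla ?Dl ?ol ?orr.
Qed.

Definition alpha X Y := omega_nabla X Y - omega_nabla Y X.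

(** Because omega is parallel and D torsion-free, expressing the brackets by D leaves only omega(D_X
    v, Y) + omega(X, D_Y v). *)
Lemma lie_derivative_omega X Y : lie_derivative v omega X Y = alpha X Y.
Proof.
rewrite /lie_derivative omega_parallel /alpha /omega_nabla -!torsion_free.
rewrite (omega_alt (D Y v)) (tensor1D _ _ (tensor2_1 Y omega_tensor)).
rewrite (tensor1D _ _ (tensor2_2 X omega_tensor)).
rewrite (tensor2Nl _ _ omega_tensor) (tensor2Nr _ _ omega_tensor); ring.
Qed.

Lemma alpha_tensor : tensor2 alpha.
Proof.
have [tl tr] := omega_nabla_tensor.
by split=> f X Y Z; rewrite /alpha ?tl ?tr; ring.
Qed.

Lemma alpha_anti X Y : alpha X Y = - alpha Y X.
Proof. by rewrite /alpha; ring. Qed.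

(** The Lie derivative along an affine field commutes with D, and D omega = 0. Concretely, Z is
    moved past v at the cost of [v, Z], and [aff] expands [v, D_X Y] by the product rule. *)
Lemma alpha_parallel Z X Y : Z (alpha X Y) = alpha (D Z X) Y + alpha X (D Z Y).
Proof.
have aff X1 Y1 : [v, D X1 Y1] = D [v, X1] Y1 + D X1 [v, Y1].
  apply/eqP; rewrite -subr_eq0 opprD addrA; apply/eqP; exact: affine_v.
have vZ f : Z (v f) = v (Z f) - [v, Z] f by rewrite bracketE; ring.
rewrite -!lie_derivative_omega /lie_derivative !vfieldD !vfieldN vZ
  !omega_parallel !vfieldD.
rewrite !omega_parallel !aff.
have oD1 X1 X2 Y1 : omega (X1 + X2) Y1 = omega X1 Y1 + omega X2 Y1.
  exact: (tensor1D _ _ (tensor2_1 Y1 omega_tensor)).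
have oD2 X1 X2 Y1 : omega Y1 (X1 + X2) = omega Y1 X1 + omega Y1 X2.
  exact: (tensor1D _ _ (tensor2_2 Y1 omega_tensor)).
by rewrite !oD1 !oD2; ring.
Qed.

(** * Exterior derivatives computed with the connection *)

Definition covd (a : V -> S) X Y := X (a Y) - a (D X Y).

Lemma ext_d1E a X Y : tensor1 a -> ext_d1 a X Y = covd a X Y - covd a Y X.
Proof.
by move=> ta; rewrite /ext_d1 /covd -torsion_free tensor1D // tensor1N //; ring.
Qed.

Lemma lie_bracket_jacobi X Y Z : [[X, Y], Z] - [[X, Z], Y] + [[Y, Z], X] = 0.
Proof.
apply: vfield_ext => f q.
rewrite -[LHS]/(([[X, Y], Z] f - [[X, Z], Y] f + [[Y, Z], X] f) q).
rewrite (_ : _ + _ = 0) //; rewrite !bracketE !vfieldD !vfieldN; ring.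
Qed.

(** After the derivative terms cancel, [a] applied to the Jacobi sum remains. *)
Lemma ext_d2_ext_d1 a X Y Z : tensor1 a -> ext_d2 (ext_d1 a) X Y Z = 0.
Proof.
move=> ta; rewrite /ext_d2 /ext_d1 !vfieldD !vfieldN !bracketE.
have nb X1 Y1 : a [X1, Y1] = - a [Y1, X1].
  rewrite -tensor1N //; congr a; apply: vfield_ext => f q.
  by rewrite -[RHS]/((- ([Y1, X1] f)) q) !bracketE opprB.
have : a [[X, Y], Z] - a [[X, Z], Y] + a [[Y, Z], X] = 0.
  by rewrite -!(tensor1N, tensor1D) // lie_bracket_jacobi tensor1_0.
rewrite (nb X [Y, Z]) => H.
rewrite -[RHS]H; ring.
Qed.

(** For a torsion-free connection the exterior derivative is an alternating sum of covariant
    derivatives, all zero here. *)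
Lemma ext_d2_parallel a X Y Z : tensor2 a ->
  (forall X1 Y1, a X1 Y1 = - a Y1 X1) ->
  (forall Z1 X1 Y1, Z1 (a X1 Y1) = a (D Z1 X1) Y1 + a X1 (D Z1 Y1)) ->
  ext_d2 a X Y Z = 0.
Proof.
move=> ta aC aP; rewrite /ext_d2 !aP -!torsion_free.
have aD1 X1 X2 Y1 : a (X1 - X2) Y1 = a X1 Y1 - a X2 Y1.
  by rewrite (tensor1D _ _ (tensor2_1 Y1 ta)) (tensor2Nl _ _ ta).
have aD2 X1 X2 Y1 : a Y1 (X1 - X2) = a Y1 X1 - a Y1 X2.
  by rewrite (tensor1D _ _ (tensor2_2 Y1 ta)) (tensor2Nr _ _ ta).
by rewrite !aD1 !aD2 (aC Y (D X Z)); ring.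
Qed.

Lemma tensor1_J (a : V -> S) : tensor1 a -> tensor1 (fun X => a (J X)).
Proof. by move=> ta f X Y; rewrite linearP ta. Qed.

Lemma tensor1_opp (a : V -> S) : tensor1 a -> tensor1 (fun X => - a X).
Proof. by move=> ta h X Y; rewrite ta; ring. Qed.

Lemma ext_d1_tensor (a : V -> S) : tensor1 a -> tensor2 (ext_d1 a).
Proof.
move=> ta; case: lc => Dl _ DL _ _; split=> f X Y Z; rewrite !ext_d1E // /covd.
  rewrite Dl DD DL !ta -[(f *: X + Y) (a Z)]/(f * X (a Z) + Y (a Z)).
  by rewrite (tensor1D _ _ ta) (tensor1D _ _ ta) !(tensor1Z _ _ ta) vfieldD
    vfieldM; ring.
rewrite Dl DD DL !ta -[(f *: X + Y) (a Z)]/(f * X (a Z) + Y (a Z)).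
by rewrite (tensor1D _ _ ta) (tensor1D _ _ ta) !(tensor1Z _ _ ta) vfieldD
  vfieldM; ring.
Qed.

Lemma ext_d1_alt (a : V -> S) X : tensor1 a -> ext_d1 a X X = 0.
Proof. by move=> ta; rewrite ext_d1E // subrr. Qed.

(** * The form [eta] and its (1, 0)-part *)

Definition eta X := omega v X.

Lemma eta_tensor : tensor1 eta.
Proof. exact: tensor2_2 omega_tensor. Qed.

Lemma ext_d1_eta X Y : ext_d1 eta X Y = alpha X Y.
Proof.
rewrite ext_d1E; last exact: eta_tensor.
by rewrite /covd /eta !omega_parallel /alpha /omega_nabla; ring.
Qed.

(* [theta] = eta10, the (1, 0)-part of eta, has real and imaginary parts
   [theta1] and [theta2]. *)
Definition theta1 X := half * eta X.
Definition theta2 X := - (half * eta (J X)).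

Lemma theta1_tensor : tensor1 theta1.
Proof. by move=> f X Y; rewrite /theta1 eta_tensor; ring. Qed.

Lemma theta2_tensor : tensor1 theta2.
Proof. by move=> f X Y; rewrite /theta2 linearP eta_tensor; ring. Qed.

(** The exterior derivative of - eta(J .), that is, twice the imaginary part of d eta10. *)
Definition kappa X Y := omega_nabla Y (J X) - omega_nabla X (J Y).

Lemma ext_d1_half (a b : V -> S) : (forall X, b X = half * a X) ->
  forall X Y, ext_d1 b X Y = half * ext_d1 a X Y.
Proof. by move=> ab X Y; rewrite /ext_d1 !ab !vfieldM !vfield_cst; ring. Qed.

Lemma ext_d1_theta1 : ext_d1 theta1 = fun X Y => half * alpha X Y.
Proof.
apply/funext => X; apply/funext => Y.
by rewrite (@ext_d1_half eta) // ext_d1_eta.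
Qed.

Lemma ext_d1_theta2 : ext_d1 theta2 = fun X Y => half * kappa X Y.
Proof.
apply/funext => X; apply/funext => Y.
rewrite (@ext_d1_half (fun X => - eta (J X))); last by move=> Z;
  rewrite /theta2 mulrN.
rewrite ext_d1E; last by apply: tensor1_opp; apply: tensor1_J;
  exact: eta_tensor.
by rewrite /covd !vfieldN /eta !omega_parallel !DJ /kappa /omega_nabla; ring.
Qed.

Lemma theta_type1 : type_part J 1 (cochain1 theta1 theta2) =
  cochain1 theta1 theta2.
Proof.
rewrite (type_part_cochain1 J theta1_tensor theta2_tensor).2.
congr cochain1; apply/funext => X;
  rewrite /theta1 /theta2 ?JJ ?(tensor1N _ eta_tensor).
  by apply/esym/half_eq; ring.
by apply/esym/half_eq; ring.
Qed.

Lemma theta_type0 : type_part J 0 (cochain1 theta1 theta2) =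
  cochain1 (fun=> 0) (fun=> 0).
Proof.
rewrite (type_part_cochain1 J theta1_tensor theta2_tensor).1.
by congr cochain1; apply/funext => X;
  rewrite /theta1 /theta2 ?JJ ?(tensor1N _ eta_tensor); ring.
Qed.

Lemma zero_tensor2 : tensor2 (fun _ _ : V => 0 : S).
Proof. by split=> f X Y Z; rewrite mulr0 addr0. Qed.

Lemma ext_d1_zero : ext_d1 (fun _ : V => 0 : S) = fun _ _ => 0.
Proof. by apply/funext => X; apply/funext => Y; rewrite /ext_d1 !vfield0;
  ring. Qed.

(** [del] and [delbar] sum over all types of their argument; for a form of pure type the other
    summand is of this shape. *)
Lemma type_part_zero p : (p <= 2)%N ->
  type_part J p (ext_d (cochain1 (fun _ : V => 0 : S) (fun _ : V => 0 : S))) =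
    0.
Proof.
rewrite ext_d_cochain1 ext_d1_zero.
have [t2 t1 t0] := type_part_cochain2 J zero_tensor2 zero_tensor2.
by case: p => [|[|[|p]]] // _; rewrite (t0, t1, t2); apply/funext => X;
  congr (_, _); rewrite /=; ring.
Qed.

Lemma del_theta : del J (cochain1 theta1 theta2) =
  type_part J 2 (cochain2 (ext_d1 theta1) (ext_d1 theta2)).
Proof.
rewrite /del !big_ord_recl big_ord0 addr0 theta_type0 theta_type1.
by rewrite type_part_zero // add0r ext_d_cochain1.
Qed.

Lemma delbar_theta : delbar J (cochain1 theta1 theta2) =
  type_part J 1 (cochain2 (ext_d1 theta1) (ext_d1 theta2)).
Proof.
rewrite /delbar !big_ord_recl big_ord0 addr0 theta_type0 theta_type1.
by rewrite type_part_zero // add0r ext_d_cochain1.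
Qed.

(* The real and imaginary parts of the (2, 0)-part of [alpha]. *)
Definition alpha20_re X Y := half * half * (alpha X Y - alpha (J X) (J Y)).
Definition alpha20_im X Y := - (half * half * (alpha (J X) Y + alpha X (J Y))).

Lemma alpha20_re_tensor : tensor2 alpha20_re.
Proof.
have [l r] := alpha_tensor.
by split=> f X Y Z; rewrite /alpha20_re !(linearP, l, r); ring.
Qed.

Lemma alpha20_im_tensor : tensor2 alpha20_im.
Proof.
have [l r] := alpha_tensor.
by split=> f X Y Z; rewrite /alpha20_im !(linearP, l, r); ring.
Qed.

Lemma alpha20_re_anti X Y : alpha20_re X Y = - alpha20_re Y X.
Proof. by rewrite /alpha20_re (alpha_anti X) (alpha_anti (J X)); ring. Qed.

Lemma alpha20_im_anti X Y : alpha20_im X Y = - alpha20_im Y X.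
Proof. by rewrite /alpha20_im (alpha_anti X) (alpha_anti (J X)); ring. Qed.

Lemma vfield_quarter (f : S) Z : Z (half * half * f) = half * half * Z f.
Proof. by rewrite !vfieldM !vfield_cst; ring. Qed.

Lemma alpha20_re_parallel Z X Y : Z (alpha20_re X Y) =
  alpha20_re (D Z X) Y + alpha20_re X (D Z Y).
Proof.
by rewrite /alpha20_re vfield_quarter vfieldD vfieldN !alpha_parallel !DJ; ring.
Qed.

Lemma alpha20_im_parallel Z X Y : Z (alpha20_im X Y) =
  alpha20_im (D Z X) Y + alpha20_im X (D Z Y).
Proof.
by rewrite /alpha20_im vfieldN vfield_quarter vfieldD !alpha_parallel !DJ; ring.
Qed.

Lemma alt_diag (b : V -> V -> S) : (forall X Y, b X Y = - b Y X) ->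
  forall X, b X X = 0.
Proof.
by move=> bC X; rewrite -[b X X]mul1r -half_half mulrDl {1}bC mulrN addNr.
Qed.

Lemma half_inj (x : S) : half * x = 0 -> x = 0.
Proof. by move=> hx; rewrite -[x]mul1r -half_half mulrDl hx addr0. Qed.

(** * The two uses of the del-delbar property *)

Hypothesis deldelbarM : deldelbar_property J.

(** The remaining part d eta01 of alpha = d eta has no (2, 0)-component. This integrability of J
    enters through [ext_d1_theta2], which rests on J being parallel. *)
Lemma type20_dtheta : type_part J 2 (cochain2 (ext_d1 theta1) (ext_d1 theta2))
  = cochain2 alpha20_re alpha20_im.
Proof.
have [-> _ _] := type_part_cochain2 J (ext_d1_tensor theta1_tensor)
  (ext_d1_tensor theta2_tensor).
rewrite ext_d1_theta1 ext_d1_theta2; congr cochain2; apply/funext => X;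
  apply/funext => Y.
  rewrite /alpha20_re /kappa /alpha !JJ !(tensor2Nl _ _ omega_nabla_tensor,
    tensor2Nr _ _ omega_nabla_tensor).
  by apply/esym/half_eq; ring.
rewrite /alpha20_im /kappa /alpha !JJ !(tensor2Nl _ _ omega_nabla_tensor,
  tensor2Nr _ _ omega_nabla_tensor).
by apply/esym/half_eq; ring.
Qed.

Lemma alpha20_type : type_part J 2 (cochain2 alpha20_re alpha20_im) =
  cochain2 alpha20_re alpha20_im.
Proof.
have [-> _ _] := type_part_cochain2 J alpha20_re_tensor alpha20_im_tensor.
congr cochain2; apply/funext => X; apply/funext => Y.
  rewrite /alpha20_re /alpha20_im !JJ !(tensor2Nl _ _ alpha_tensor, tensor2Nr _
    _ alpha_tensor).
  by apply/esym/half_eq; rewrite -[RHS]mul1r -half_half; ring.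
rewrite /alpha20_re /alpha20_im !JJ !(tensor2Nl _ _ alpha_tensor, tensor2Nr _ _
  alpha_tensor).
by apply/esym/half_eq; rewrite -[RHS]mul1r -half_half; ring.
Qed.

Lemma alpha20_eq0 : cochain2 alpha20_re alpha20_im = 0.
Proof.
(* For [q := 0] the conclusion [deldelbar_exact] is by definition the vanishing of the form. *)
apply: (deldelbarM (p := 2) (q := 0)).
- exact: (cochain2_form alpha20_re_tensor alpha20_im_tensor (alt_diag
  alpha20_re_anti) (alt_diag alpha20_im_anti)).
- by split => //; exact: alpha20_type.
- rewrite ext_d_cochain2; apply/funext => X /=.
  rewrite (ext_d2_parallel _ _ _ alpha20_re_tensor alpha20_re_anti
    alpha20_re_parallel).
  by rewrite (ext_d2_parallel _ _ _ alpha20_im_tensor alpha20_im_anti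
    alpha20_im_parallel).
- left; exists (cochain1 theta1 theta2);
  first exact: cochain1_form theta1_tensor theta2_tensor.
  by rewrite del_theta type20_dtheta.
Qed.

Definition pair_fields X Y (i : 'I_2) : V := if i == ord0 then X else Y.

Lemma cochain2_pair (a b : V -> V ->
  S) X Y : cochain2 a b (pair_fields X Y) = (a X Y, b X Y).
Proof. by []. Qed.

(** As [alpha] is real, its (2, 0)- and (0, 2)-parts are conjugate, and the real part of one already
    detects both. *)
Lemma alphaJJ X Y : alpha (J X) (J Y) = alpha X Y.
Proof.
have H : alpha20_re X Y = 0 :=
  congr1 (fun c : cochain A 2 => (c (pair_fields X Y)).1) alpha20_eq0.
have /half_inj/half_inj/eqP : half * (half * (alpha X Y - alpha (J X) (J Y))) =
  0.
  by rewrite mulrA; exact: H.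
by rewrite subr_eq0 => /eqP ->.
Qed.

Lemma alphaJ X Y : alpha (J X) Y = - alpha X (J Y).
Proof. by rewrite -[alpha X (J Y)]alphaJJ JJ (tensor2Nr _ _ alpha_tensor)
  opprK. Qed.

(** The difference of the two sides is alpha(J X, Y) + alpha(X, J Y). *)
Lemma kappaJJ X Y : kappa (J X) (J Y) = kappa X Y.
Proof.
have := alphaJ X Y; rewrite /alpha /kappa !JJ !(tensor2Nl _ _
  omega_nabla_tensor, tensor2Nr _ _ omega_nabla_tensor).
move=> H; apply/eqP; rewrite -subr_eq0; apply/eqP.
by rewrite -(subrr (- (omega_nabla X (J Y) - omega_nabla (J Y) X))) -{1}H; ring.
Qed.

Lemma dtheta_type : type_part J 1 (cochain2 (ext_d1 theta1) (ext_d1 theta2)) =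
  cochain2 (ext_d1 theta1) (ext_d1 theta2).
Proof.
have [_ -> _] := type_part_cochain2 J (ext_d1_tensor theta1_tensor)
  (ext_d1_tensor theta2_tensor).
rewrite ext_d1_theta1 ext_d1_theta2; congr cochain2; apply/funext => X;
  apply/funext => Y.
  by rewrite alphaJJ; apply/esym/half_eq; ring.
by rewrite kappaJJ; apply/esym/half_eq; ring.
Qed.

Lemma dtheta_deldelbar : exists u w, cochain2 (ext_d1 theta1) (ext_d1 theta2) =
  del J (delbar J (cochain0 u w)).
Proof.
have [b [_ _ E]] : deldelbar_exact J 1 1 (cochain2 (ext_d1 theta1) (ext_d1
  theta2)).
  apply: deldelbarM.
  - apply: (cochain2_form (ext_d1_tensor theta1_tensor) (ext_d1_tensor
    theta2_tensor)).
      by move=> X; exact: ext_d1_alt theta1_tensor.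
    by move=> X; exact: ext_d1_alt theta2_tensor.
  - by split => //; exact: dtheta_type.
  - rewrite ext_d_cochain2; apply/funext => X /=.
    by rewrite !ext_d2_ext_d1 //; [exact: theta2_tensor | exact: theta1_tensor].
  - right; exists (cochain1 theta1 theta2);
    first exact: cochain1_form theta1_tensor theta2_tensor.
    by rewrite delbar_theta dtheta_type.
by have [u [w bE]] := cochain0_surj b; exists u, w; rewrite E bE.
Qed.

(** * The Hessian and the real part of del delbar *)

Definition hess w X Y := X (Y w) - (D X Y) w.

Lemma hessC w X Y : hess w X Y = hess w Y X.
Proof.
have := congr1 (fun Z : V => Z w) (torsion_free X Y).
rewrite -[LHS]/(D X Y w - D Y X w) bracketE /hess => H.
apply/eqP; rewrite -subr_eq0; apply/eqP.
transitivity (X (Y w) - Y (X w) - (D X Y w - D Y X w)); first by ring.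
by rewrite H subrr.
Qed.

Lemma eval_tensor (h : S) : tensor1 (fun X : V => X h).
Proof. by []. Qed.

(** Symmetry moves the sign to the first argument, in which D is tensorial by definition. *)
Lemma hess_oppr w X Y : hess w X (- Y) = - hess w X Y.
Proof.
rewrite hessC [in RHS]hessC /hess; case: lc => Dl _ _ _ _.
have tD Z : tensor1 (fun X1 => (D X1 Z) w) by move=> f X' Y'; rewrite Dl.
rewrite (tensor1N _ (tD X)) (tensor1N _ (eval_tensor _)); ring.
Qed.

Section Delbar.
Variables u w : S.

(** With [delbar_im], the real and imaginary parts of delbar (u + i w), the (0, 1)-part of the
    differential. *)
Definition delbar_re X : S := half * (X u - J X w).
Definition delbar_im X : S := half * (X w + J X u).

Lemma delbar_re_tensor : tensor1 delbar_re.
Proof.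
move=> f X Y; rewrite /delbar_re linearP (eval_tensor u) (eval_tensor w); ring.
Qed.

Lemma delbar_im_tensor : tensor1 delbar_im.
Proof.
move=> f X Y; rewrite /delbar_im linearP (eval_tensor u) (eval_tensor w); ring.
Qed.

Lemma delbar_cochain0 : delbar J (cochain0 u w) = cochain1 delbar_re delbar_im.
Proof.
rewrite /delbar big_ord_recl big_ord0 addr0 type_part_cochain0 ext_d_cochain0.
by rewrite (type_part_cochain1 J (eval_tensor u) (eval_tensor w)).1.
Qed.

Lemma delbar_type0 : type_part J 0 (cochain1 delbar_re delbar_im) =
  cochain1 delbar_re delbar_im.
Proof.
rewrite (type_part_cochain1 J delbar_re_tensor delbar_im_tensor).1.
congr cochain1; apply/funext => X; rewrite /delbar_re /delbar_im ?JJ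
  ?(tensor1N _ (eval_tensor u)) ?(tensor1N _ (eval_tensor w)).
  by apply/esym/half_eq; ring.
by apply/esym/half_eq; ring.
Qed.

Lemma delbar_type1 : type_part J 1 (cochain1 delbar_re delbar_im) =
  cochain1 (fun=> 0) (fun=> 0).
Proof.
rewrite (type_part_cochain1 J delbar_re_tensor delbar_im_tensor).2.
by congr cochain1; apply/funext => X; rewrite /delbar_re /delbar_im ?JJ
  ?(tensor1N _ (eval_tensor u)) ?(tensor1N _ (eval_tensor w)); ring.
Qed.

Lemma del_delbar : del J (cochain1 delbar_re delbar_im) =
  type_part J 1 (cochain2 (ext_d1 delbar_re) (ext_d1 delbar_im)).
Proof.
rewrite /del !big_ord_recl big_ord0 addr0 delbar_type0 delbar_type1.
by rewrite type_part_zero // addr0 ext_d_cochain1.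
Qed.

(** The summand X u drops out, since du is closed; as J is parallel, the differential of dw(J .)
    involves only the Hessian of [w]. *)
Lemma ext_d1_delbar_re X Y : ext_d1 delbar_re X Y =
  half * (hess w Y (J X) - hess w X (J Y)).
Proof.
rewrite (@ext_d1_half (fun X => X u - J X w)) // /ext_d1 /hess !vfieldD
  !vfieldN.
have -> : J [X, Y] w = J (D X Y) w - J (D Y X) w by rewrite -torsion_free
  linearB.
by rewrite !DJ bracketE; congr (_ * _); ring.
Qed.

(** By symmetry of the Hessian the right-hand side is unchanged when X, Y become J X, J Y, so the
    projection to type (1, 1) has no effect on it. *)
Lemma re_deldelbar X Y :
  (del J (delbar J (cochain0 u w)) (pair_fields X Y)).1 =
  half * (hess w Y (J X) - hess w X (J Y)).
Proof.
rewrite delbar_cochain0 del_delbar.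
have [_ -> _] := type_part_cochain2 J (ext_d1_tensor delbar_re_tensor)
  (ext_d1_tensor delbar_im_tensor).
rewrite cochain2_pair /= !ext_d1_delbar_re !JJ.
rewrite !hess_oppr (hessC w (J X)) (hessC w (J Y)).
by apply/esym/half_eq; ring.
Qed.

End Delbar.

(** [alpha] is twice the real part of d eta10, so the factors [half] cancel; taking Y = J X makes
    both Hessian terms diagonal. *)
Lemma alpha_hessian : exists w, forall X, alpha X (J X) =
  hess w X X + hess w (J X) (J X).
Proof.
have [u [w E]] := dtheta_deldelbar; exists w => X.
have H : half * alpha X (J X) = half * (hess w (J X) (J X) - hess w X (J (J
  X))).
  by rewrite -(re_deldelbar u) -E cochain2_pair /= ext_d1_theta1.
rewrite JJ in H.
move: H; rewrite hess_oppr opprK => /eqP;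
  rewrite -subr_eq0 -mulrBr => /eqP/half_inj/eqP.
by rewrite subr_eq0 addrC => /eqP.
Qed.

(** * Vanishing of [beta] and of [alpha] *)

Hypothesis hausdorffM : hausdorff_space M.
Hypothesis compactM : compact [set: M].
Hypothesis connectedM : connected [set: M].

Definition beta X Y := alpha X (J Y).

Lemma beta_linear f X Y Z : beta (f *: X + Y) Z = f * beta X Z + beta Y Z.
Proof. by have [l _] := alpha_tensor; exact: l. Qed.

Lemma beta_sym X Y : beta X Y = beta Y X.
Proof. by rewrite /beta alpha_anti alphaJ opprK. Qed.

Lemma beta_parallel Z X Y : Z (beta X Y) = beta (D Z X) Y + beta X (D Z Y).
Proof. by rewrite /beta alpha_parallel DJ. Qed.

Lemma beta_diag0 X : beta X X = 0.
Proof.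
apply: smooth_ext => q; have M0 : [set: M] !=set0 by exists q.
have [w Hw] := alpha_hessian.
(* At a maximum the first-order term (D_Z Z) w' vanishes, and the Hessian reduces to Z (Z w'). *)
have hess_max (w' : S) p Z : (forall x, w' x <= w' p) -> hess w' Z Z p <= 0.
  move=> mp; have [_ h2] := vfield_at_max hausdorffM Z mp.
  have [h1 _] := vfield_at_max hausdorffM (D Z Z) mp.
  by rewrite -[leLHS]/(Z (Z w') p - D Z Z w' p) h1 subr0.
have cw (w' : S) : {within [set: M], continuous w'}.
  by apply: continuous_subspaceT; exact: smooth_continuous.
have ex_max (w' : S) : exists p, forall x, w' x <= w' p.
  have [p _ Hp] := compact_EVT_max M0 compactM (cw w').
  by exists p => x; apply: Hp; rewrite inE.
have [p Hp] := ex_max w; have [p' Hp'] := ex_max (- w).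
have le0 : beta X X q <= 0.
  apply: (nonpos_everywhere hausdorffM beta_linear beta_sym beta_parallel (p :=
    p) connectedM) => Y.
  by rewrite /beta Hw smoothDE -[leRHS]addr0 lerD // hess_max.
have hessN Y : hess (- w) Y Y = - hess w Y Y.
  by rewrite /hess !vfieldN; ring.
(* The same argument for [- beta], again symmetric and parallel, at a minimum of [w], which is a
   maximum of [- w]. *)
have ge0 : - beta X X q <= 0.
  have bl f X1 Y Z : - beta (f *: X1 + Y) Z = f * (- beta X1 Z) + - beta Y Z.
    by rewrite beta_linear; ring.
  have bC X1 Y : - beta X1 Y = - beta Y X1 by rewrite beta_sym.
  have bp Z X1 Y : Z (- beta X1 Y) = - beta (D Z X1) Y + - beta X1 (D Z Y).
    by rewrite vfieldN beta_parallel; ring.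
  apply: (@nonpos_everywhere R n M A hausdorffM (fun X Y => - beta X Y) D bl bC
    bp p' connectedM) => Y.
  by rewrite /beta Hw opprD -!hessN smoothDE -[leRHS]addr0 lerD // hess_max.
by apply: le_anti; rewrite le0 -oppr_le0.
Qed.

(** Polarization gives beta = 0, and J J = - 1 recovers [alpha] from [beta]. *)
Lemma alpha_eq0 X Y : alpha X Y = 0.
Proof.
have tb : tensor2 beta.
  by split=> f X1 Y1 Z; [exact: beta_linear | rewrite beta_sym beta_linear
    !(beta_sym _ Z)].
have b0 X1 Y1 : beta X1 Y1 = 0.
  have := beta_diag0 (X1 + Y1).
  rewrite (tensor1D _ _ (tensor2_1 _ tb)) !(tensor1D _ _ (tensor2_2 _ tb)).
  rewrite !beta_diag0 add0r addr0 (beta_sym Y1) => H.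
  by rewrite -[LHS]mul1r -half_half mulrDl -mulrDr H mulr0.
have := b0 X (J Y); rewrite /beta JJ (tensor2Nr _ _ alpha_tensor) => /eqP.
by rewrite oppr_eq0 => /eqP.
Qed.

End Affine.

Theorem corollary3p2 (R : realType) (n : nat) (M : topologicalType)
    (A : atlas R n M)
    (hausdorffM : hausdorff_space M)
    (compactM : compact [set: M])
    (connectedM : connected [set: M])
    (g : vfield A -> vfield A -> smooth_fun A)
    (D : vfield A -> vfield A -> vfield A)
    (J : {linear vfield A -> vfield A})
    (kahlerM : is_pseudo_kahler g D J)
    (deldelbarM : deldelbar_property J)
    (v : vfield A)
    (affine_v : is_affine D v) :
  forall X Y : vfield A, lie_derivative v (kahler_form g J) X Y = 0.
Proof.
move=> X Y; rewrite (lie_derivative_omega v kahlerM).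
exact: (alpha_eq0 kahlerM affine_v deldelbarM hausdorffM compactM connectedM).
Qed.
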